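(* A sequence $\omega\in\Omega=\{0,1\}^{\mathbb{N}}$ is a Bernoulli sequence if and only if there exists $p\in[0,1]$ such that $\omega$ is Martin-Löf random with respect to the Bernoulli measure $B_p$ relative to the oracle $p$.
   Context: $B_p$ is the measure of independent bits each equal to 1 with probability $p$. A function $t:\Omega\to[0,+\infty]$ is lower semicomputable if for each rational $r$ the set $\{\omega:r<t(\omega)\}$ is the union of an enumerable family of intervals $x\Omega$ (sequences with prefix $x$), uniformly in $r$. A Bernoulli test is a lower semicomputable $t\ge0$ with $\int t\,dB_p\le1$ for all $p\in[0,1]$; there is a universal (maximal up to a multiplicative constant) Bernoulli test $\mathbf{t}_{\mathcal{B}}$, and $\omega$ is called Bernoulli if $\mathbf{t}_{\mathcal{B}}(\omega)<\infty$. The oracle $p$ provides the bits of the binary expansion of $p$ (for dyadic rationals either expansion, both being computable). Martin-Löf randomness with respect to $B_p$ relative to oracle $p$: $\omega$ does not belong to $\bigcap_i U_i$ for any sequence of sets $U_i$ that are unions of families of intervals enumerable with oracle $p$ uniformly in $i$ and satisfy $B_p(U_i)\le2^{-i}$. *)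

(* Defs.v *)
From HB Require Import structures.
From Stdlib Require Cantor.
From mathcomp Require Import all_boot all_order all_algebra.
From mathcomp Require Import ring lra.
From mathcomp Require Import all_classical all_reals all_analysis.
From mathcomp Require Import measurable_realfun.
Set Implicit Arguments.
Unset Strict Implicit.
Unset Printing Implicit Defensive.
Import Order.TTheory GRing.Theory Num.Theory.
Import numFieldNormedType.Exports.

Local Open Scope classical_set_scope.
Local Open Scope ring_scope.

Definition cylinder (x : seq bool) : set (nat -> bool) :=
  [set w | mkseq w (size x) = x].

(* {0,1}^nat with the sigma-algebra generated by the cylinders. *)
Definition Omega := g_sigma_algebraType (range cylinder).

(* Unary partial recursive functions relative to an oracle; tuples are coded
   by the Cantor pairing. *)
Inductive code : Type :=
| Zero | Succ | Fst | Snd | Oracle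
| Pair of code & code
| Comp of code & code
| Prec of code & code
| Min of code.

Definition pairn (m n : nat) : nat := Cantor.to_nat (m, n).

(* [eval o c a v]: on input [a], the program [c] with oracle [o] halts with
   output [v]. *)
Fixpoint eval (o : nat -> bool) (c : code) (a v : nat) : Prop :=
  match c with
  | Zero => v = 0%N
  | Succ => v = a.+1
  | Fst => v = (Cantor.of_nat a).1
  | Snd => v = (Cantor.of_nat a).2
  | Oracle => v = o a
  | Pair f g => exists y z, [/\ eval o f a y, eval o g a z & v = pairn y z]
  | Comp f g => exists2 y, eval o g a y & eval o f y v
  | Prec f g => exists x n (s : nat -> nat),
      [/\ a = pairn x n, eval o f x (s 0%N),
          forall k, (k < n)%N -> eval o g (pairn x (pairn k (s k))) (s k.+1)
        & v = s n]
  | Min f => eval o f (pairn a v) 0%N /\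
      forall k, (k < v)%N -> exists y, eval o f (pairn a k) y.+1
  end.

(* A computable oracle adds nothing: recursion relative to [no_oracle] is
   plain recursion. *)
Definition no_oracle : nat -> bool := fun=> false.

(* Bijective base-2 numeration, a bijection between binary strings and nat. *)
Definition code_string (x : seq bool) : nat :=
  foldr (fun (b : bool) (m : nat) => (m.*2 + b).+1%N) 0%N x.

(* The i-th member of the uniformly enumerable family of sets of strings
   listed by the program [c] with oracle [o]. *)
Definition enumerated (o : nat -> bool) (c : code) (i : nat) : set (seq bool) :=
  [set x | exists n, eval o c (pairn i n) (code_string x)].

Definition effectively_open (o : nat -> bool) (U : nat -> set Omega) : Prop :=
  exists c, forall i, U i = \bigcup_(x in enumerated o c i) cylinder x.

(* A surjective coding of the rationals, as (a - b) / (d + 1). *)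
Definition rat_of_nat (k : nat) : rat :=
  let: (m, d) := Cantor.of_nat k in
  let: (a, b) := Cantor.of_nat m in
  (a%:R - b%:R) / d.+1%:R.

Lemma rat_of_nat_surj (r : rat) : exists k, rat_of_nat k = r.
Proof.
have dE : denq r = `|denq r|.-1.+1%:Z.
  by have := denq_gt0 r; case: (denq r) => [[|n]|n].
pose a := if 0 <= numq r then `|numq r|%N else 0%N.
pose b := if 0 <= numq r then 0%N else `|numq r|%N.
exists (Cantor.to_nat (Cantor.to_nat (a, b), `|denq r|.-1)).
rewrite /rat_of_nat !Cantor.cancel_of_to.
have -> : a%:R - b%:R = (numq r)%:~R :> rat.
  rewrite /a /b; case: ifPn => n0; first by rewrite subr0 natr_absz ger0_norm.
  by rewrite sub0r natr_absz ltr0_norm ?ltNge// rmorphN opprK.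
by rewrite -[RHS]divq_num_den {2}dE.
Qed.

Definition lower_semicomputable (R : realType) (t : Omega -> \bar R) : Prop :=
  effectively_open no_oracle
    (fun k => [set w | ((ratr (rat_of_nat k))%:E < t w)%E]).

(* Under the uniform measure on [0, 1[, [coin p x 0] is 1 with probability p,
   and [bernoulli_shift p x] is uniform and independent of it. *)
Definition bernoulli_shift (R : realType) (p x : R) : R :=
  if 1 - p <= x then (x - (1 - p)) / p else x / (1 - p).

Definition coin (R : realType) (p : R) : measurableTypeR R -> Omega :=
  fun x n => 1 - p <= iter n (bernoulli_shift p) x.

Lemma coin_preimage_cons (R : realType) (p : R) (b : bool) (s : seq bool) :
  coin p @^-1` cylinder (b :: s) =
  [set x | (1 - p <= x) = b] `&`
  (bernoulli_shift p @^-1` (coin p @^-1` cylinder s)).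
Proof.
have E x n : coin p x n.+1 = coin p (bernoulli_shift p x) n.
  by rewrite /coin iterSr.
apply/seteqP; split => x; rewrite /cylinder /= /mkseq /=.
  case=> bE h; split=> //; rewrite -[RHS]h -[in RHS](addn0 1%N) iotaDl -map_comp.
  by apply: eq_map => n; rewrite /= add1n E.
case=> bE h; congr (_ :: _); first exact: bE.
rewrite -[RHS]h -[in LHS](addn0 1%N) iotaDl -map_comp.
by apply: eq_map => n; rewrite /= add1n E.
Qed.

Lemma measurable_bernoulli_shift (R : realType) (p : R) :
  measurable_fun setT (bernoulli_shift p).
Proof.
apply: measurable_fun_ifT.
- exact: measurable_fun_ler.
- by apply: measurable_funM => //; apply: measurable_funB.
- exact: measurable_funM.
Qed.

Lemma measurable_coin (R : realType) (p : R) : measurable_fun setT (coin p).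
Proof.
apply: (@measurability _ _ _ _ _ _ (range cylinder : set (set Omega))) => //.
move=> _ [_ [x _ <-] <-]; rewrite setTI.
elim: x => [|b s IH].
  by rewrite (_ : _ @^-1` _ = setT)//; apply/seteqP; split.
rewrite coin_preimage_cons; apply: measurableI; last first.
  by rewrite -[X in measurable X]setTI; apply: measurable_bernoulli_shift.
rewrite -[X in measurable X]setTI.
have h : measurable_fun setT (fun x : R => 1 - p <= x).
  exact: measurable_fun_ler.
exact: (h measurableT [set b]).
Qed.

HB.instance Definition _ (R : realType) (p : R) :=
  isMeasurableFun.Build _ _ _ _ (coin p) (measurable_coin p).

(* B_p, for p in [0, 1], as the law of [coin p] under the uniform measure;
   [bernoulli_measure_cylinder] characterizes it. Junk law for other p. *)
Definition bernoulli_measure (R : realType) (p : R) : probability Omega R :=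
  distribution (uniform_prob (@ltr01 R)) (coin p).

Lemma coin_cylinder_itv (R : realType) (p : R) (s : seq bool) :
  0 <= p <= 1 ->
  exists a : R, [/\ 0 <= a, a + \prod_(b <- s) (if b then p else 1 - p) <= 1 &
    (coin p @^-1` cylinder s) `&` `[0, 1[ =
    `[a, a + \prod_(b <- s) (if b then p else 1 - p)[%classic].
Proof.
move=> /andP[p0 p1]; elim: s => [|b s [a [a0 a1 E]]].
  exists 0; rewrite big_nil add0r; split=> //.
  by apply/seteqP; split => x /=; [case|].
rewrite big_cons.
set w := \prod_(b <- s) _ in a1 E *.
have w0 : 0 <= w by apply: prodr_ge0 => -[] _ //; rewrite subr_ge0.
have {}E x : 0 <= x < 1 ->
    (coin p @^-1` cylinder s) x <-> a <= x < a + w.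
  move=> x01; have := congr1 (@^~ x) E.
  by rewrite /= !in_itv/= x01 => <-; split=> [|[]].
case: b.
- exists (1 - p + p * a); split; [nra|nra|].
  apply/seteqP; split => x.
    rewrite coin_preimage_cons /= !in_itv/= /bernoulli_shift.
    move=> [[/[dup] px -> ] h /andP[x0 x1]].
    have pp : 0 < p by lra.
    have xE : x = p * ((x - (1 - p)) / p) + (1 - p) by field; rewrite gt_eqF.
    move: h; set y := _ / p in xE *.
    have y01 : 0 <= y < 1 by apply/andP; split; nra.
    by move/(E _ y01) => /andP[? ?]; apply/andP; split; nra.
  rewrite coin_preimage_cons /= !in_itv/= /bernoulli_shift => /andP[h1 h2].
  have pp : 0 < p.
    rewrite lt_neqAle p0 andbT; apply/eqP => p00.
    by move: h1 h2; rewrite -p00; lra.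
  have px : 1 - p <= x by nra.
  rewrite px.
  have xE : x = p * ((x - (1 - p)) / p) + (1 - p) by field; rewrite gt_eqF.
  set y := _ / p in xE *.
  have h : a <= y < a + w by apply/andP; split; nra.
  have y01 : 0 <= y < 1 by case/andP: h => ? ?; apply/andP; split; lra.
  by split; [split=> //; exact/(E _ y01) | apply/andP; split; nra].
- exists ((1 - p) * a); split; [nra|nra|].
  apply/seteqP; split => x.
    rewrite coin_preimage_cons /= !in_itv/= /bernoulli_shift.
    move=> [[px]]; rewrite px => h /andP[x0 x1].
    move/negbT: px; rewrite -ltNge => px.
    have xE : x = (1 - p) * (x / (1 - p)) by field; rewrite gt_eqF//; lra.
    move: h; set y := _ / _ in xE *.
    have y01 : 0 <= y < 1 by apply/andP; split; nra.
    by move/(E _ y01) => /andP[? ?]; apply/andP; split; nra.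
  rewrite coin_preimage_cons /= !in_itv/= /bernoulli_shift => /andP[h1 h2].
  have pp : 0 < 1 - p.
    rewrite lt_neqAle subr_ge0 p1 andbT; apply/eqP => p00.
    by move: h1 h2; rewrite -p00; lra.
  have px : x < 1 - p by nra.
  rewrite leNgt px /=.
  have xE : x = (1 - p) * (x / (1 - p)) by field; rewrite gt_eqF//; lra.
  set y := _ / _ in xE *.
  have h : a <= y < a + w by apply/andP; split; nra.
  have y01 : 0 <= y < 1 by case/andP: h => ? ?; apply/andP; split; lra.
  by split; [split=> //; exact/(E _ y01) | apply/andP; split; nra].
Qed.

Lemma bernoulli_measure_cylinder (R : realType) (p : R) (s : seq bool) :
  0 <= p <= 1 ->
  bernoulli_measure p (cylinder s) =
  (\prod_(b <- s) (if b then p else 1 - p))%:E.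
Proof.
move=> p01; have [a [a0 a1 E]] := coin_cylinder_itv s p01.
set w := \prod_(b <- s) _ in a1 E *.
have w0 : 0 <= w.
  by case/andP: p01 => ? ?; apply: prodr_ge0 => -[] _ //; rewrite subr_ge0.
have mC : measurable (coin p @^-1` cylinder s).
  rewrite -[X in measurable X]setTI; apply: measurable_coin => //.
  by apply: sub_sigma_algebra; exists s.
transitivity (uniform_prob (@ltr01 R) (coin p @^-1` cylinder s)) => //.
rewrite /uniform_prob integral_uniform_pdf setIC integral_mkcondr.
rewrite -integral_itv_bndo_bndc; last first.
  apply/measurable_funTS/(measurable_restrictT _ _).1 => //.
  apply/measurable_funTS/measurable_EFinP; exact: measurable_uniform_pdf.
have pdf1 (x : R) : x \in `[a, a + w[ -> (uniform_pdf 0 1 x)%:E = 1%E.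
  rewrite in_itv/= => /andP[ax xa].
  by rewrite /uniform_pdf subr0 invr1 ifT//; apply/andP; split; lra.
rewrite -integral_mkcondr setIC E (eq_integral (cst 1%E)); last first.
  by move=> x; rewrite inE/=; exact: pdf1.
rewrite integral_cst//= mul1e lebesgue_measure_itv/= lte_fin ltrDl.
have [_|w_le0] := ltP 0 w; first by rewrite -EFinB addrAC subrr add0r.
by congr EFin; apply/eqP; rewrite eq_le w0.
Qed.

(* A dyadic [p] in ]0, 1[ has two expansions. *)
Definition binary_expansion (R : realType) (p : R) (o : nat -> bool) : Prop :=
  series (fun n => (o n)%:R / 2 ^+ n.+1) @ \oo --> p.

Definition ml_random (R : realType) (P : probability Omega R)
    (o : nat -> bool) (w : Omega) : Prop :=
  forall U : nat -> set Omega, effectively_open o U ->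
    (forall i, (P (U i) <= (2 ^- i)%:E)%E) -> ~ (\bigcap_i U i) w.

(* The two expansions of a dyadic rational are both computable, so it does not
   matter which one serves as the oracle. *)
Definition ml_random_bernoulli (R : realType) (p : R) (w : Omega) : Prop :=
  exists2 o, binary_expansion p o & ml_random (bernoulli_measure p) o w.

Definition bernoulli_test (R : realType) (t : Omega -> \bar R) : Prop :=
  [/\ forall w, (0 <= t w)%E,
      lower_semicomputable t
    & forall p : R, 0 <= p <= 1 -> (\int[bernoulli_measure p]_w t w <= 1)%E].

Definition universal_bernoulli_test (R : realType) (t : Omega -> \bar R) :
    Prop :=
  bernoulli_test t /\
  forall t' : Omega -> \bar R, bernoulli_test t' ->
    exists2 c : R, 0 < c & forall w, (t' w <= c%:E * t w)%E.

(* Any two universal tests bound each other up to a constant, so finiteness does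
   not depend on the choice of [t]. *)
Definition bernoulli_sequence (R : realType) (w : Omega) : Prop :=
  exists2 t : Omega -> \bar R, universal_bernoulli_test t & (t w < +oo)%E.

(* Main.v *)
(** Let u(w, o) be the largest value, among all programs e, of a weight 2^-(e+1)
    times the test that e computes with oracle o, where e is cut off as soon as
    its integral for the Bernoulli measures whose parameter p has an expansion
    extending the part of o read so far might exceed 2. Put t(w) = inf_o u(w, o).
    - By compactness of the space of oracles (König's lemma), t is lower
      semicomputable; its integral for B_p is at most that of u(., o) for an
      expansion o of p. So t is a Bernoulli test.
    - A Bernoulli test is computed by some e that ignores its oracle, and is
      never cut off, so t is universal.
    - If t(w) is finite then u(w, o) is finite for some o, and w is random for
      the real p with expansion o relative to o: a Martin-Löf test (U_i) gives
      the test sup {2^i | w in U_(2i+1)}, which occurs in u.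
    - If w is random for B_p then t(w) is finite by Markov's inequality.
    Only powers of two are used as values; finite sets and strings are coded by
    the bits of natural numbers, so that every computation is bounded arithmetic. *)

From Stdlib Require Cantor.
From mathcomp Require Import all_boot all_order all_algebra.
From mathcomp Require Import zify ring lra.
From mathcomp Require Import all_classical all_reals all_analysis.
From mathcomp Require Import measurable_realfun.
Require Import Defs.
Set Implicit Arguments.
Unset Strict Implicit.
Unset Printing Implicit Defensive.
Import Order.TTheory GRing.Theory Num.Theory.
Import numFieldNormedType.Exports.

(** * Computable functions *)

Definition fstn (a : nat) : nat := (Cantor.of_nat a).1.
Definition sndn (a : nat) : nat := (Cantor.of_nat a).2.

Lemma pairnK1 m n : fstn (pairn m n) = m.
Proof. by rewrite /fstn /pairn Cantor.cancel_of_to. Qed.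

Lemma pairnK2 m n : sndn (pairn m n) = n.
Proof. by rewrite /sndn /pairn Cantor.cancel_of_to. Qed.

Lemma pairn_eta a : pairn (fstn a) (sndn a) = a.
Proof. by rewrite /pairn /fstn /sndn -surjective_pairing Cantor.cancel_to_of. Qed.

Lemma leq_pairnl m n : m <= pairn m n.
Proof. by have := Cantor.to_nat_non_decreasing m n; rewrite /pairn; lia. Qed.

Lemma leq_pairnr m n : n <= pairn m n.
Proof. by have := Cantor.to_nat_non_decreasing m n; rewrite /pairn; lia. Qed.

Class encodable (X : Type) := enc : X -> nat.
#[export] Instance encodable_nat : encodable nat := id.
#[export] Instance encodable_bool : encodable bool := nat_of_bool.
#[export] Instance encodable_prod X Y {eX : encodable X} {eY : encodable Y} :
  encodable (X * Y) := fun x => pairn (enc x.1) (enc x.2).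

(** Quantifying over all oracles lets the same program serve in relative and in plain
    computations. *)
Definition computes {X Y} {eX : encodable X} {eY : encodable Y}
    (c : code) (F : X -> Y) : Prop :=
  forall o x v, eval o c (enc x) v <-> v = enc (F x).

Definition computable {X Y} {eX : encodable X} {eY : encodable Y}
    (F : X -> Y) : Prop := exists c, computes c F.

Section closure.
Context {X Y Z : Type} {eX : encodable X} {eY : encodable Y} {eZ : encodable Z}.

Lemma computable_id : computable (fun x : X => x).
Proof.
exists (Pair Fst Snd) => o x v /=; split=> [[y [z [-> -> ->]]]|->].
  exact: pairn_eta.
by do 2 eexists; split; [reflexivity|reflexivity|rewrite -[LHS]pairn_eta].
Qed.

Lemma computable_comp (F : Y -> Z) (G : X -> Y) :
  computable F -> computable G -> computable (fun x => F (G x)).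
Proof.
move=> [f hf] [g hg]; exists (Comp f g) => o x v /=; split.
  by move=> [y /hg -> /hf].
by move=> ->; exists (enc (G x)); [exact/hg|exact/hf].
Qed.

Lemma computable_pair (F : X -> Y) (G : X -> Z) :
  computable F -> computable G -> computable (fun x => (F x, G x)).
Proof.
move=> [f hf] [g hg]; exists (Pair f g) => o x v /=; split.
  by move=> [y [z [/hf -> /hg -> ->]]].
by move=> ->; do 2 eexists; split; [exact/hf|exact/hg|].
Qed.

Lemma computable_fst (F : X -> Y * Z) :
  computable F -> computable (fun x => (F x).1).
Proof.
move=> [f hf]; exists (Comp Fst f) => o x v /=; split.
  by move=> [y /hf -> ->]; exact: pairnK1.
by move=> ->; eexists; [exact/hf|symmetry; exact: pairnK1].
Qed.

Lemma computable_snd (F : X -> Y * Z) :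
  computable F -> computable (fun x => (F x).2).
Proof.
move=> [f hf]; exists (Comp Snd f) => o x v /=; split.
  by move=> [y /hf -> ->]; exact: pairnK2.
by move=> ->; eexists; [exact/hf|symmetry; exact: pairnK2].
Qed.

Lemma computable_S (F : X -> nat) :
  computable F -> computable (fun x => (F x).+1).
Proof.
move=> [f hf]; exists (Comp Succ f) => o x v /=; split.
  by move=> [y /hf -> ->].
by move=> ->; eexists; [exact/hf|].
Qed.

Lemma computable_cst (y : Y) : computable (fun _ : X => y).
Proof.
rewrite /computable /computes; elim: (enc y) => [|n [c hc]].
  by exists Zero.
exists (Comp Succ c) => o x v /=; split.
  by move=> [k /hc -> ->].
by move=> ->; exists n; [exact/hc|].
Qed.

Lemma computable_iteri (N : X -> nat) (F : X -> nat -> Y -> Y) (A : X -> Y) :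
  computable N -> computable A ->
  computable (fun x : X * nat * Y => F x.1.1 x.1.2 x.2) ->
  computable (fun x => iteri (N x) (F x) (A x)).
Proof.
move=> [n hn] [a ha] [f hf].
(* [Prec] hands its step the code of (x, (k, s)), while [f] expects that of ((x, k), s). *)
pose g := Comp f (Pair (Pair Fst (Comp Fst Snd)) (Comp Snd Snd)).
have gP o x k (s : Y) v :
    eval o g (pairn (enc x) (pairn k (enc s))) v <-> v = enc (F x k s).
  pose P := Pair (Pair Fst (Comp Fst Snd)) (Comp Snd Snd).
  have hP u : eval o P (pairn (enc x) (pairn k (enc s))) u <->
      u = enc (x, k, s).
    rewrite /= /enc /= /encodable_prod /= /enc.
    split=> [[y [z [[y' [z' [-> [? -> ->] ->]]] [? -> ->] ->]]]|->].
      by rewrite -!/(fstn _) -!/(sndn _) !(pairnK1, pairnK2).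
    exists (pairn (enc x) k), (enc s); split=> //.
      exists (enc x), k; split=> //; rewrite -?/(fstn _) ?pairnK1//.
      eexists; first reflexivity.
      by rewrite -/(fstn _) -/(sndn _) !(pairnK1, pairnK2).
    eexists; first reflexivity.
    by rewrite -!/(sndn _) !(pairnK1, pairnK2).
  split=> [[u /hP -> /hf]//|->].
  by exists (enc (x, k, s)); [exact/hP|exact/hf].
exists (Comp (Prec a g) (Pair (Pair Fst Snd) n)) => o x v.
have hP u : eval o (Pair (Pair Fst Snd) n) (enc x) u <-> u = pairn (enc x) (N x).
  split=> [[y [z [[y' [z' [-> -> ->]]] /hn -> ->]]]|->].
    by rewrite -/(fstn _) -/(sndn _) pairn_eta.
  exists (enc x), (N x); split=> //; last exact/hn.
  by do 2 eexists; split; [reflexivity..|rewrite -[LHS]pairn_eta].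
split.
  move=> [u /hP -> [x' [m [s [/(congr1 (fun a => (fstn a, sndn a)))]]]]].
  rewrite !(pairnK1, pairnK2) => -[<- <-] /ha s0 sS ->.
  have: N x <= N x by [].
  elim: {-2}(N x) => [//|k IH kn].
  by have := sS k kn; rewrite IH 1?ltnW// => /gP.
move=> ->; exists (pairn (enc x) (N x)); first exact/hP.
exists (enc x), (N x), (fun k => enc (iteri k (F x) (A x))); split=> //.
  exact/ha.
by move=> k kn; apply/gP.
Qed.

End closure.

Create HintDb comp.
#[local] Hint Constants Opaque : comp.
#[local] Hint Variables Opaque : comp.
#[local] Hint Resolve computable_id computable_pair computable_fst computable_snd
  computable_S computable_cst computable_iteri : comp.

Ltac comp := solve [eauto 100 with comp].

(** * Bounded arithmetic *)

Section arithmetic.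
Context {X : Type} {eX : encodable X}.
Implicit Types (A B C : X -> nat) (P Q : X -> bool).

Lemma eq_computable {Y} {eY : encodable Y} (F G : X -> Y) :
  F =1 G -> computable F -> computable G.
Proof. by move=> /funext ->. Qed.

Lemma computable_fstn A : computable A -> computable (fun x => fstn (A x)).
Proof.
move=> h; apply: (@computable_comp _ nat) h; exists Fst => o x v.
by rewrite /= /enc.
Qed.

Lemma computable_sndn A : computable A -> computable (fun x => sndn (A x)).
Proof.
move=> h; apply: (@computable_comp _ nat) h; exists Snd => o x v.
by rewrite /= /enc.
Qed.

Lemma computable_pairn A B :
  computable A -> computable B -> computable (fun x => pairn (A x) (B x)).
Proof. by move=> [a ha] [b hb]; have [c hc] := computable_pair
  (ex_intro _ a ha) (ex_intro _ b hb); exists c => o x v; rewrite (hc o x v). Qed.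

Lemma computable_if {Y} {eY : encodable Y} P (F G : X -> Y) :
  computable P -> computable F -> computable G ->
  computable (fun x => if P x then F x else G x).
Proof.
move=> hP hF hG.
have hN : computable (fun x => nat_of_bool (P x)) by move: hP => [c hc]; exists c.
(* A branch is an iteration of length 0 or 1. *)
apply: (eq_computable (F := fun x => iteri (P x) (fun _ _ => F x) (G x))).
  by move=> x; case: (P x).
apply: computable_iteri => //.
apply: (computable_comp (F := F)) => //; comp.
Qed.

Lemma computable_nat_of_bool P :
  computable P -> computable (fun x => nat_of_bool (P x)).
Proof. by case=> c hc; exists c. Qed.

Lemma computable_andb P Q :
  computable P -> computable Q -> computable (fun x => P x && Q x).
Proof.
by move=> hP hQ; exact: (computable_if hP hQ (computable_cst false)).
Qed.

Lemma computable_orb P Q :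
  computable P -> computable Q -> computable (fun x => P x || Q x).
Proof.
by move=> hP hQ; exact: (computable_if hP (computable_cst true) hQ).
Qed.

Lemma computable_implb P Q :
  computable P -> computable Q -> computable (fun x => P x ==> Q x).
Proof.
by move=> hP hQ; exact: (computable_if hP hQ (computable_cst true)).
Qed.

Lemma computable_negb P : computable P -> computable (fun x => ~~ P x).
Proof.
by move=> hP; exact: (computable_if hP (computable_cst false) (computable_cst true)).
Qed.

End arithmetic.
#[local] Hint Resolve computable_fstn computable_sndn computable_pairn computable_if
  computable_nat_of_bool computable_andb computable_orb computable_implb computable_negb : comp.

Lemma computable_fun2 {X Y : Type} {eX : encodable X} {eY : encodable Y}
  (f : nat -> nat -> Y) (A B : X -> nat) :
  computable (fun x : nat * nat => f x.1 x.2) ->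
  computable A -> computable B -> computable (fun x => f (A x) (B x)).
Proof.
move=> hf hA hB.
exact: (computable_comp hf (computable_pair hA hB)).
Qed.

Lemma computable_fun1 {X Y : Type} {eX : encodable X} {eY : encodable Y}
  (f : nat -> Y) (A : X -> nat) :
  computable f -> computable A -> computable (fun x => f (A x)).
Proof. exact: computable_comp. Qed.

Section arithmetic2.
Context {X : Type} {eX : encodable X}.
Implicit Types (A B C : X -> nat) (P Q : X -> bool).

Lemma computable_pred A : computable A -> computable (fun x => (A x).-1).
Proof.
apply: computable_fun1 => //.
by apply: (eq_computable (F := fun n => iteri n (fun k _ => k) 0)) => [[]|]//; comp.
Qed.

Lemma computable_add A B :
  computable A -> computable B -> computable (fun x => A x + B x).
Proof.
apply: computable_fun2 => //.
apply: (eq_computable (F := fun x => iteri x.2 (fun _ s => s.+1) x.1)); last comp.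
by move=> [m n] /=; elim: n => [|n IH] /=; rewrite ?addn0 ?addnS ?IH.
Qed.

End arithmetic2.
#[local] Hint Resolve computable_pred computable_add : comp.

Section arithmetic3.
Context {X : Type} {eX : encodable X}.
Implicit Types (A B C : X -> nat) (P Q : X -> bool).

Lemma computable_sub A B :
  computable A -> computable B -> computable (fun x => A x - B x).
Proof.
apply: computable_fun2 => //.
apply: (eq_computable (F := fun x => iteri x.2 (fun _ s => s.-1) x.1)); last comp.
by move=> [m n] /=; elim: n => [|n IH] /=; rewrite ?subn0 ?subnS ?IH.
Qed.

Lemma computable_mul A B :
  computable A -> computable B -> computable (fun x => A x * B x).
Proof.
apply: computable_fun2 => //.
apply: (eq_computable (F := fun x => iteri x.2 (fun _ s => x.1 + s) 0)); last comp.
by move=> [m n] /=; elim: n => [|n IH] /=; rewrite ?muln0 ?mulnS ?IH.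
Qed.

Lemma computable_odd A : computable A -> computable (fun x => odd (A x)).
Proof.
apply: computable_fun1 => //.
apply: (eq_computable (F := fun n => iteri n (fun _ s => ~~ s) false)); last comp.
by elim=> //= n ->.
Qed.

Lemma computable_eq0 A : computable A -> computable (fun x => A x == 0).
Proof.
apply: (computable_fun1 (f := fun n => n == 0)).
apply: (eq_computable (F := fun n => iteri n (fun _ _ => false) true)); last comp.
by elim.
Qed.

End arithmetic3.
#[local] Hint Resolve computable_sub computable_mul computable_odd : comp.

Section arithmetic4.
Context {X : Type} {eX : encodable X}.
Implicit Types (A B C : X -> nat) (P Q : X -> bool).

Lemma computable_exp A B :
  computable A -> computable B -> computable (fun x => A x ^ B x).
Proof.
apply: computable_fun2 => //.
apply: (eq_computable (F := fun x => iteri x.2 (fun _ s => x.1 * s) 1)); last comp.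
by move=> [m n] /=; elim: n => [|n IH] /=; rewrite ?expn0 ?expnS ?IH.
Qed.

Lemma computable_leq A B :
  computable A -> computable B -> computable (fun x => A x <= B x).
Proof. by move=> hA hB; apply: computable_eq0; comp. Qed.

Lemma computable_half A : computable A -> computable (fun x => (A x)./2).
Proof.
apply: computable_fun1 => //.
apply: (eq_computable (F := fun n => iteri n (fun k s => odd k + s) 0)); last comp.
by elim=> //= n ->; rewrite uphalf_half.
Qed.

Lemma computable_max A B :
  computable A -> computable B -> computable (fun x => maxn (A x) (B x)).
Proof.
by move=> hA hB; apply: (eq_computable (F := fun x => A x + (B x - A x)));
  [move=> x; rewrite maxnE|comp].
Qed.

End arithmetic4.
#[local] Hint Resolve computable_exp computable_leq computable_half computable_max : comp.

Definition exb (n : nat) (P : nat -> bool) : bool := has P (iota 0 n).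
Definition allb (n : nat) (P : nat -> bool) : bool := all P (iota 0 n).

Lemma exbP n (P : nat -> bool) : reflect (exists2 k, k < n & P k) (exb n P).
Proof.
apply: (iffP hasP) => -[k]; rewrite ?mem_iota => kn Pk; exists k => //.
by rewrite mem_iota.
Qed.

Lemma allbP n (P : nat -> bool) : reflect (forall k, k < n -> P k) (allb n P).
Proof.
apply: (iffP allP) => h k; first by move=> kn; apply: h; rewrite mem_iota.
by rewrite mem_iota; exact: h.
Qed.

Section arithmetic5.
Context {X : Type} {eX : encodable X}.
Implicit Types (A B C : X -> nat) (P Q : X -> bool).

Lemma computable_eqn A B :
  computable A -> computable B -> computable (fun x => A x == B x).
Proof.
move=> hA hB; apply: (eq_computable (F := fun x => (A x <= B x) && (B x <= A x)));
  [by move=> x; rewrite eqn_leq|comp].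
Qed.

Lemma computable_div2X A B :
  computable A -> computable B -> computable (fun x => A x %/ 2 ^ B x).
Proof.
apply: (computable_fun2 (f := fun a b => a %/ 2 ^ b)).
apply: (eq_computable (F := fun x => iteri x.2 (fun _ s => s./2) x.1)); last comp.
move=> [m n] /=; elim: n => [|n IH] /=; first by rewrite divn1.
by rewrite IH -divn2 -divnMA -expnSr.
Qed.

Lemma computable_exb A (P : X -> nat -> bool) :
  computable A -> computable (fun x : X * nat => P x.1 x.2) ->
  computable (fun x => exb (A x) (P x)).
Proof.
move=> hA hP.
apply: (eq_computable (F := fun x => iteri (A x) (fun k s => s || P x k) false)).
  move=> x; rewrite /exb; elim: (A x) => // n IH.
  by rewrite -{2}addn1 iotaD has_cat /= orbF -IH.
apply: computable_iteri => //; first comp.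
apply: computable_orb; first comp.
apply: (computable_comp (F := fun x : X * nat => P x.1 x.2)) => //; comp.
Qed.

Lemma computable_allb A (P : X -> nat -> bool) :
  computable A -> computable (fun x : X * nat => P x.1 x.2) ->
  computable (fun x => allb (A x) (P x)).
Proof.
move=> hA hP.
apply: (eq_computable (F := fun x => ~~ exb (A x) (fun k => ~~ P x k))).
  by move=> x; rewrite /exb -all_predC /allb; apply: eq_all => k /=; rewrite negbK.
apply: computable_negb; apply: (computable_exb hA) => //; comp.
Qed.

Lemma computable_bigop (op : nat -> nat -> nat) (idx : nat)
    (F : X -> nat -> nat) A :
  (forall n (f : nat -> nat), \big[op/idx]_(i < n.+1) f i =
     op (\big[op/idx]_(i < n) f i) (f n)) ->
  computable (fun x : nat * nat => op x.1 x.2) ->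
  computable A -> computable (fun x : X * nat => F x.1 x.2) ->
  computable (fun x => \big[op/idx]_(i < A x) F x i).
Proof.
move=> opS hop hA hF.
apply: (eq_computable (F := fun x => iteri (A x) (fun k s => op s (F x k)) idx)).
  move=> x; elim: (A x) => [|n IH]; first by rewrite big_ord0.
  by rewrite (opS n (F x)) /= IH.
apply: computable_iteri => //; first comp.
apply: (computable_fun2 hop); first comp.
apply: (computable_comp (F := fun x : X * nat => F x.1 x.2)) => //; comp.
Qed.

Lemma computable_sum A (F : X -> nat -> nat) :
  computable A -> computable (fun x : X * nat => F x.1 x.2) ->
  computable (fun x => \sum_(i < A x) F x i).
Proof.
by apply: computable_bigop; [move=> n f; rewrite big_ord_recr|comp].
Qed.

Lemma computable_prod A (F : X -> nat -> nat) :
  computable A -> computable (fun x : X * nat => F x.1 x.2) ->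
  computable (fun x => \prod_(i < A x) F x i).
Proof.
by apply: computable_bigop; [move=> n f; rewrite big_ord_recr|comp].
Qed.

Lemma computable_bigmax A (F : X -> nat -> nat) :
  computable A -> computable (fun x : X * nat => F x.1 x.2) ->
  computable (fun x => \max_(i < A x) F x i).
Proof.
by apply: computable_bigop; [move=> n f; rewrite big_ord_recr|comp].
Qed.

End arithmetic5.
#[local] Hint Resolve computable_eqn computable_div2X computable_exb computable_allb
  computable_sum computable_prod computable_bigmax : comp.

Lemma computable_mod2X {X : Type} {eX : encodable X} (A B : X -> nat) :
  computable A -> computable B -> computable (fun x => A x %% 2 ^ B x).
Proof.
move=> hA hB.
apply: (eq_computable (F := fun x => A x - A x %/ 2 ^ B x * 2 ^ B x)); last comp.
by move=> x; rewrite [in X in X - _](divn_eq (A x) (2 ^ B x)) addKn.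
Qed.
#[local] Hint Resolve computable_mod2X : comp.

(** * Finite derivations of computations *)

Arguments fstn : simpl never.
Arguments sndn : simpl never.
Arguments pairn : simpl never.

(** * Binary digits of natural numbers *)

Definition bit (z j : nat) : bool := odd (z %/ 2 ^ j).

(** The first bit is the least significant, so that truncation to the first [k] bits is reduction
    modulo 2^k. *)
Definition prefix_num (f : nat -> bool) (n : nat) : nat := \sum_(j < n) f j * 2 ^ j.

Lemma num_recl f n : prefix_num f n.+1 = f 0 + (prefix_num (f \o succn) n).*2.
Proof.
rewrite /prefix_num big_ord_recl muln1 -muln2 big_distrl /=; congr addn.
by apply: eq_bigr => i _; rewrite expnSr mulnA.
Qed.

Lemma num_recr f n : prefix_num f n.+1 = prefix_num f n + f n * 2 ^ n.
Proof. exact: big_ord_recr. Qed.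

Lemma bitS z j : bit z j.+1 = bit z./2 j.
Proof. by rewrite /bit expnS divnMA divn2. Qed.

Lemma num_lt f n : prefix_num f n < 2 ^ n.
Proof.
elim: n f => [|n IH] f; first by rewrite /prefix_num big_ord0.
by rewrite num_recl expnS; have := IH (f \o succn); case: (f 0); lia.
Qed.

Lemma bit_num f n j : bit (prefix_num f n) j = (j < n) && f j.
Proof.
elim: j n f => [|j IH] [|n] f; rewrite ?bitS; try by rewrite /prefix_num big_ord0 /bit ?div0n.
  by rewrite num_recl /bit divn1 oddD odd_double addbF oddb.
by rewrite num_recl half_bit_double IH.
Qed.

Lemma eq_num f g n : (forall j, j < n -> f j = g j) -> prefix_num f n = prefix_num g n.
Proof. by move=> fg; apply: eq_bigr => i _; rewrite fg. Qed.

Lemma num_bit z n : z < 2 ^ n -> prefix_num (bit z) n = z.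
Proof.
elim: n z => [|n IH] z zn; first by rewrite /prefix_num big_ord0; case: z zn.
rewrite num_recl (@eq_num _ (bit z./2)); last by move=> j _; rewrite /= bitS.
rewrite IH; last by move: zn; rewrite expnS; lia.
by rewrite /bit divn1 odd_double_half.
Qed.

Lemma num_mod f k n : k <= n -> prefix_num f n %% 2 ^ k = prefix_num f k.
Proof.
move=> kn; rewrite -(subnKC kn); elim: (n - k) => [|m IH].
  by rewrite addn0 modn_small// num_lt.
rewrite addnS num_recr -modnDmr expnD mulnCA modnMr addn0.
exact: IH.
Qed.

Lemma bit_lt z j : bit z j -> j < z.
Proof.
rewrite /bit; have [//|zj] := ltnP j z.
by rewrite divn_small// (leq_ltn_trans zj)// ltn_expl.
Qed.

Lemma bit_mod z n j : j < n -> bit (z %% 2 ^ n) j = bit z j.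
Proof.
move=> jn.
have zz : z < 2 ^ maxn n z by rewrite (leq_trans (ltn_expl z (ltnSn 1)))// leq_exp2l// leq_maxr.
by rewrite -{1}(num_bit zz) num_mod ?leq_maxl// bit_num jn.
Qed.

(** * Gödel numbers and derivations *)

Definition triple (e a v : nat) : nat := pairn e (pairn a v).

Fixpoint index (c : code) : nat :=
  match c with
  | Zero => pairn 0 0
  | Succ => pairn 1 0
  | Fst => pairn 2 0
  | Snd => pairn 3 0
  | Oracle => pairn 4 0
  | Pair f g => pairn 5 (pairn (index f) (index g))
  | Comp f g => pairn 6 (pairn (index f) (index g))
  | Prec f g => pairn 7 (pairn (index f) (index g))
  | Min f => pairn 8 (index f)
  end.

(* [l] is the bit set of claims [triple e a v], read "program [e] maps [a] to
   [v]"; the claim is an immediate consequence of those in [l] and of the first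
   [n] answers of the oracle, which are the bits of [z]. *)
Definition justified (n z l e a v : nat) : bool :=
  let k := fstn e in let d := sndn e in
  if k == 0 then v == 0 else
  if k == 1 then v == a.+1 else
  if k == 2 then v == fstn a else
  if k == 3 then v == sndn a else
  if k == 4 then (a < n) && (v == bit z a) else
  if k == 5 then
    bit l (triple (fstn d) a (fstn v)) && bit l (triple (sndn d) a (sndn v)) else
  if k == 6 then
    exb l (fun y => bit l (triple (sndn d) a y) && bit l (triple (fstn d) y v)) else
  if k == 7 then
    if sndn a == 0 then bit l (triple (fstn d) (fstn a) v) else
    exb l (fun y => bit l (triple e (pairn (fstn a) (sndn a).-1) y) &&
      bit l (triple (sndn d) (pairn (fstn a) (pairn (sndn a).-1 y)) v)) else
  if k == 8 then
    bit l (triple d (pairn a v) 0) &&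
    allb v (fun i => exb l (fun y => bit l (triple d (pairn a i) y.+1)))
  else false.

Definition derivation (n z l : nat) : bool :=
  allb l (fun u => bit l u ==>
    justified n z l (fstn u) (fstn (sndn u)) (sndn (sndn u))).

(** A position set in [l] is less than [l], so the bounded check reaches every claim. *)
Lemma derivationP n z l :
  reflect (forall e a v, bit l (triple e a v) -> justified n z l e a v)
    (derivation n z l).
Proof.
apply: (iffP (allbP _ _)) => h.
  move=> e a v b; have := h _ (bit_lt b); rewrite b /=.
  by rewrite /triple !(pairnK1, pairnK2).
move=> u _; apply/implyP => b; apply: h.
by rewrite /triple !pairn_eta.
Qed.

(** This is why [justified] may bound its search for intermediate values by [l]. *)
Lemma triple_lt l e a v : bit l (triple e a v) -> v < l.
Proof.
move/bit_lt; apply: leq_ltn_trans.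
exact: leq_trans (leq_pairnr a v) (leq_pairnr e _).
Qed.

(** Derivations cannot be circular: a claim is justified by claims about proper subprograms or, for
    [Prec], about the same program with a smaller counter. Hence an induction on [c], with an inner
    one on the counter. *)
Lemma sound_derivation (o : nat -> bool) n l c a v :
  derivation n (prefix_num o n) l -> bit l (triple (index c) a v) -> eval o c a v.
Proof.
move=> /derivationP D.
elim: c a v => [| | | | |f IHf g IHg|f IHf g IHg|f IHf g IHg|f IHf] a v /[dup] b /D;
  rewrite /justified /index -?/index !(pairnK1, pairnK2) /=.
- by move/eqP.
- by move/eqP.
- by move/eqP.
- by move/eqP.
- by rewrite bit_num => /andP[-> /eqP ->].
- move=> /andP[/IHf h1 /IHg h2]; exists (fstn v), (sndn v); split=> //.
  by rewrite pairn_eta.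
- by move/exbP => [y _ /andP[/IHg h1 /IHf h2]]; exists y.
- move=> _; pose x := fstn a.
  suff [s [s0 sS sv]] : exists s : nat -> nat, [/\ eval o f x (s 0),
      forall k, k < sndn a -> eval o g (pairn x (pairn k (s k))) (s k.+1) &
      v = s (sndn a)].
    by exists x, (sndn a), s; split=> //; rewrite pairn_eta.
  have := pairn_eta a; rewrite -/x; move: b; set n' := sndn a => b aE.
  rewrite -{}aE in b.
  elim: n' v b => [|m IH] v /D; rewrite /justified /= !(pairnK1, pairnK2) /=.
    by move=> /IHf h; exists (fun=> v).
  move=> /exbP[y _ /andP[/IH[s [s0 sS ->]] /IHg h]].
  exists (fun k => if k <= m then s k else v); split=> //; last by rewrite ltnn.
  move=> k; rewrite ltnS => km; rewrite km; case: ltnP => mk; first exact: sS.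
  by have -> : k = m by lia.
- move=> /andP[/IHf h1 /allbP h2]; split=> // k /h2 /exbP[y _ /IHf h].
  by exists y.
Qed.

(* Quantifying over every [l] that contains [M] makes this monotone in [M], so
   that derivations can be merged. *)
Definition follows (n : nat) (o : nat -> bool) (M : seq nat) (e a v : nat) : Prop :=
  forall l z, (forall j, j < n -> bit z j = o j) -> (forall u, u \in M -> bit l u) ->
  forall n', n <= n' -> justified n' z l e a v.

Definition derives (n : nat) (o : nat -> bool) (M : seq nat) : Prop :=
  forall e a v, triple e a v \in M -> follows n o M e a v.

Lemma follows_mono n o M n' M' e a v : n <= n' -> {subset M <= M'} ->
  follows n o M e a v -> follows n' o M' e a v.
Proof.
move=> nn MM h l z zo lM k nk; apply: h.
- by move=> j jn; apply: zo; lia.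
- by move=> u /MM; exact: lM.
- by lia.
Qed.

Lemma derives_cat n n' o M M' : derives n o M -> derives n' o M' ->
  derives (maxn n n') o (M ++ M').
Proof.
move=> h h' e a v; rewrite mem_cat => /orP[/h|/h'];
  apply: follows_mono; rewrite ?leq_maxl ?leq_maxr// => u;
  by rewrite mem_cat => ->; rewrite ?orbT.
Qed.

Lemma derives_cons n n' o M e a v : derives n o M -> follows n' o M e a v ->
  derives (maxn n n') o (triple e a v :: M).
Proof.
move=> h h' e' a' v'; rewrite inE => /orP[/eqP/(congr1 (fun u => (fstn u,(fstn (sndn u),
  sndn (sndn u)))))|/h].
  rewrite /triple !(pairnK1, pairnK2) => -[-> -> ->].
  apply: follows_mono h'; rewrite ?leq_maxr// => u.
  by rewrite inE => ->; rewrite orbT.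
apply: follows_mono; rewrite ?leq_maxl// => u.
by rewrite inE => ->; rewrite orbT.
Qed.

Definition derivable (o : nat -> bool) (e a v : nat) : Prop :=
  exists n M, derives n o M /\ triple e a v \in M.

Lemma derivable_all (o : nat -> bool) (m : nat) (E A V : nat -> nat) :
  (forall i, i < m -> derivable o (E i) (A i) (V i)) ->
  exists n M, derives n o M /\ forall i, i < m -> triple (E i) (A i) (V i) \in M.
Proof.
elim: m => [|m IH] h; first by exists 0, [::].
have [|n [M [D hM]]] := IH; first by move=> i im; apply: h; lia.
have [n' [M' [D' hM']]] := h m (ltnSn m).
exists (maxn n n'), (M ++ M'); split; first exact: derives_cat.
move=> i; rewrite ltnS leq_eqVlt mem_cat => /orP[/eqP ->|/hM ->//].
by rewrite hM' orbT.
Qed.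

(** A common form of all the rules, with [m] premises. Only [Oracle], whose tag is 4, reads the
    oracle, at position [a], and so needs [a.+1] of its bits. *)
Lemma derivable_step (o : nat -> bool) (m : nat) (E A V : nat -> nat) e a v :
  (forall i, i < m -> derivable o (E i) (A i) (V i)) ->
  (forall n M, (forall i, i < m -> triple (E i) (A i) (V i) \in M) ->
     follows (maxn n (if fstn e == 4 then a.+1 else 0)) o M e a v) ->
  derivable o e a v.
Proof.
move=> /derivable_all[n [M [D hM]]] /(_ n M hM) F.
eexists _, (triple e a v :: M); split; last exact: mem_head.
exact: derives_cons D F.
Qed.

Lemma complete_derivable (o : nat -> bool) c a v :
  eval o c a v -> derivable o (index c) a v.
Proof.
pose nil0 := fun _ : nat => 0.
elim: c a v => [| | | | |f IHf g IHg|f IHf g IHg|f IHf g IHg|f IHf] a v /=.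
- move=> ->; apply: (@derivable_step o 0 nil0 nil0 nil0) => [//|n M _ l z _ _ n' _].
  by rewrite /justified !pairnK1.
- move=> ->; apply: (@derivable_step o 0 nil0 nil0 nil0) => [//|n M _ l z _ _ n' _].
  by rewrite /justified !pairnK1 /=.
- move=> ->; apply: (@derivable_step o 0 nil0 nil0 nil0) => [//|n M _ l z _ _ n' _].
  by rewrite /justified !pairnK1 /=.
- move=> ->; apply: (@derivable_step o 0 nil0 nil0 nil0) => [//|n M _ l z _ _ n' _].
  by rewrite /justified !pairnK1 /=.
- move=> ->; apply: (@derivable_step o 0 nil0 nil0 nil0) => [//|n M _ l z zo _ n'].
  rewrite pairnK1 eqxx geq_max => /andP[_ an].
  by rewrite /justified !pairnK1 /= an zo ?eqxx// ?pairnK1 leq_maxr.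
- move=> [y [y' [/IHf h1 /IHg h2 ->]]].
  apply: (@derivable_step o 2 (fun i => if i == 0 then index f else index g)
    (fun=> a) (fun i => if i == 0 then y else y')).
    by case=> [|[]].
  move=> n M h l z _ lM n' _; rewrite /justified !(pairnK1, pairnK2) /=.
  by rewrite !lM ?(h 0)// ?(h 1).
- move=> [y /IHg h1 /IHf h2].
  apply: (@derivable_step o 2 (fun i => if i == 0 then index g else index f)
    (fun i => if i == 0 then a else y) (fun i => if i == 0 then y else v)).
    by case=> [|[]].
  move=> n M h l z _ lM n' _; rewrite /justified !(pairnK1, pairnK2) /=.
  have h0 := lM _ (h 0 isT); have {}h1 := lM _ (h 1 isT).
  by apply/exbP; exists y; [exact: triple_lt h0|rewrite h0 h1].
- move=> [x [n [s [-> /IHf s0 sS ->]]]].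
  rewrite -/(index (Prec f g)).
  (* The induction runs over the counters up to [n], the range in which [sS] holds. *)
  have: n <= n by [].
  elim: {-2}n => [_|k IH kn].
    apply: (@derivable_step o 1 (fun=> index f) (fun=> x) (fun=> s 0)) => //.
    move=> n' M h l z _ lM n'' _; rewrite /justified !(pairnK1, pairnK2) /=.
    by apply: lM; exact: (h 0).
  apply: (@derivable_step o 2 (fun i => if i == 0 then index (Prec f g) else index g)
    (fun i => if i == 0 then pairn x k else pairn x (pairn k (s k)))
    (fun i => if i == 0 then s k else s k.+1)).
    by case=> [|[]]//= _; [apply: IH; lia|apply: IHg; apply: sS].
  move=> n' M h l z _ lM n'' _; rewrite /justified !(pairnK1, pairnK2) /=.
  have h0 := lM _ (h 0 isT); have h1 := lM _ (h 1 isT).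
  by apply/exbP; exists (s k); [exact: triple_lt h0|rewrite h0 h1].
- move=> [/IHf h0 hS].
  (* Predecessors of the nonzero values of [f] before [v]; these values enter the premises. *)
  have [s sP] : exists s, forall k, k < v -> eval o f (pairn a k) (s k).+1.
    have [k|s sP] := @boolp.choice _ _ (fun k y => k < v -> eval o f (pairn a k) y.+1).
      by have [/hS[y]|_] := ltnP k v; [exists y|exists 0].
    by exists s.
  apply: (@derivable_step o v.+1 (fun=> index f) (fun i => pairn a i)
    (fun i => if i == v then 0 else (s i).+1)).
    move=> i; rewrite ltnS leq_eqVlt; case: eqVneq => [->//|_] /= iv.
    exact/IHf/sP.
  move=> n M h l z _ lM n' _; rewrite /justified !(pairnK1, pairnK2) /=.
  have hv := lM _ (h v (ltnSn v)); rewrite eqxx in hv; rewrite hv /=.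
  apply/allbP => i iv; apply/exbP; exists (s i).
    have := lM _ (h i (ltnW iv)); rewrite ltn_eqF// => /triple_lt; lia.
  by have := lM _ (h i (ltnW iv)); rewrite ltn_eqF.
Qed.

Lemma complete_derivation (o : nat -> bool) c a v :
  eval o c a v -> exists n l, bit l (triple (index c) a v) /\
    forall n', n <= n' -> derivation n' (prefix_num o n') l.
Proof.
move=> /complete_derivable[n [M [D inM]]].
(* Above all members of [M], so that [B] bits suffice to code [M] as a bit set. *)
pose B := (\max_(u <- M) u).+1.
have lM u : bit (prefix_num (mem M) B) u = (u \in M).
  rewrite bit_num; apply/andP/idP => [[_]//|uM]; split=> //.
  by rewrite ltnS; apply: (@leq_bigmax_seq _ M xpredT id).
exists n, (prefix_num (mem M) B); split; first by rewrite lM.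
move=> n' nn'; apply/derivationP => e a' v'; rewrite lM => /D; apply=> //.
- by move=> j jn; rewrite bit_num (leq_trans jn nn').
- by move=> u; rewrite lM.
Qed.

Lemma justified_prefix (o : nat -> bool) n n' l e a v : n <= n' ->
  justified n (prefix_num o n) l e a v -> justified n' (prefix_num o n') l e a v.
Proof.
move=> nn'; rewrite /justified; repeat case: ifP => _ //.
rewrite !bit_num => /andP[an]; rewrite an (leq_trans an nn') /=.
by [].
Qed.

Lemma derivation_prefix (o : nat -> bool) n n' l : n <= n' ->
  derivation n (prefix_num o n) l -> derivation n' (prefix_num o n') l.
Proof.
move=> nn' /derivationP D; apply/derivationP => e a v /D.
exact: justified_prefix.
Qed.

(* After [n] steps with the oracle prefix coded by [z], program [e] has listed
   the string of code [v] in its [i]-th set. *)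
Definition stage (e n z i v : nat) : bool :=
  exb n (fun l => exb n (fun q => derivation n z l && bit l (triple e (pairn i q) v))).

Lemma stage_prefix (o : nat -> bool) e n n' i v : n <= n' ->
  stage e n (prefix_num o n) i v -> stage e n' (prefix_num o n') i v.
Proof.
move=> nn' /exbP[l ln /exbP[q qn /andP[D b]]].
apply/exbP; exists l; first exact: leq_trans nn'.
apply/exbP; exists q; first exact: leq_trans nn'.
by rewrite b (derivation_prefix nn' D).
Qed.

Lemma stageP (o : nat -> bool) c i v :
  (exists n, stage (index c) n (prefix_num o n) i v) <->
  exists q, eval o c (pairn i q) v.
Proof.
split=> [[n /exbP[l _ /exbP[q _ /andP[D b]]]]|[q /complete_derivation[n [l [b D]]]]].
  by exists q; exact: sound_derivation D b.
(* One bound for the oracle bits, the code of the derivation and the index of the listing. *)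
exists (maxn n (maxn l q).+1); set m := maxn n _.
have [lm [qm nm]] : l < m /\ q < m /\ n <= m by rewrite /m; lia.
by apply/exbP; exists l => //; apply/exbP; exists q => //; rewrite b D.
Qed.

(** Thanks to these bounds, the ranges of [i] and [k] in [level] below miss nothing. *)
Lemma stage_lt e n z i v : stage e n z i v -> (i < n) && (v < n).
Proof.
move=> /exbP[l ln /exbP[q _ /andP[_ b]]].
rewrite (ltn_trans (triple_lt b) ln) andbT (ltn_trans _ ln)//.
move/bit_lt: b; apply: leq_ltn_trans; apply: leq_trans (leq_pairnr e _).
exact: leq_trans (leq_pairnl i q) (leq_pairnl _ v).
Qed.

(** * Computability of derivations and stages *)

Lemma computable_bit {X} {eX : encodable X} (A B : X -> nat) :
  computable A -> computable B -> computable (fun x => bit (A x) (B x)).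
Proof. by move=> hA hB; rewrite /bit; comp. Qed.
#[local] Hint Resolve computable_bit : comp.

Lemma computable_triple {X} {eX : encodable X} (E A V : X -> nat) :
  computable E -> computable A -> computable V ->
  computable (fun x => triple (E x) (A x) (V x)).
Proof. by move=> *; rewrite /triple; comp. Qed.
#[local] Hint Resolve computable_triple : comp.

Lemma computable_justified :
  computable (fun x : nat * nat * nat * (nat * nat * nat) =>
    justified x.1.1.1 x.1.1.2 x.1.2 x.2.1.1 x.2.1.2 x.2.2).
Proof. rewrite /justified; do !(apply: computable_if; [comp| |]); comp. Qed.

Lemma computable_derivation :
  computable (fun x : nat * nat * nat => derivation x.1.1 x.1.2 x.2).
Proof.
rewrite /derivation; apply: computable_allb; first comp.
apply: computable_implb; first comp.
apply: (computable_comp (G := fun x : nat * nat * nat * nat => (x.1,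
  (fstn x.2, fstn (sndn x.2), sndn (sndn x.2)))) computable_justified); comp.
Qed.

Lemma computable_stage_uncurried :
  computable (fun x : nat * nat * nat * (nat * nat) =>
    stage x.1.1.1 x.1.1.2 x.1.2 x.2.1 x.2.2).
Proof.
rewrite /stage; apply: computable_exb; first comp.
apply: computable_exb; first comp.
apply: computable_andb; last comp.
apply: (computable_comp computable_derivation
  (G := fun x : nat * nat * nat * (nat * nat) * nat * nat =>
    (x.1.1.1.1.2, x.1.1.1.2, x.1.2))).
comp.
Qed.

Lemma computable_stage {X} {eX : encodable X} (E N Z I V : X -> nat) :
  computable E -> computable N -> computable Z -> computable I -> computable V ->
  computable (fun x => stage (E x) (N x) (Z x) (I x) (V x)).
Proof.
move=> hE hN hZ hI hV.
apply: (computable_comp (G := fun x => (E x, N x, Z x, (I x, V x)))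
  computable_stage_uncurried).
comp.
Qed.
#[local] Hint Resolve computable_stage : comp.

(** * Trimmed tests *)

(** In bijective numeration the strings of length [k] occupy the codes from 2^k - 1 to 2^(k+1) - 2;
    this is the code of the first [k] bits of [y]. *)
Definition prefix_code (y k : nat) : nat := y %% 2 ^ k + (2 ^ k).-1.

Lemma code_string_mkseq (w : nat -> bool) k :
  code_string (mkseq w k) = prefix_num w k + (2 ^ k).-1.
Proof.
elim: k w => [|k IH] w; first by rewrite /prefix_num big_ord0.
rewrite num_recl expnS; have -> : mkseq w k.+1 = w 0 :: mkseq (w \o succn) k.
  rewrite /mkseq /=; congr cons; rewrite -[1]addn0 iotaDl -map_comp.
  by apply: eq_map => j.
by rewrite /= IH; have := expn_gt0 2 k; case: (w 0) => /=; lia.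
Qed.

Lemma prefix_code_num (w : nat -> bool) n k : k <= n ->
  prefix_code (prefix_num w n) k = code_string (mkseq w k).
Proof. by move=> kn; rewrite /prefix_code num_mod// code_string_mkseq. Qed.

Lemma code_string_uniq y n y' n' : y < 2 ^ n -> y' < 2 ^ n' ->
  y + (2 ^ n).-1 = y' + (2 ^ n').-1 -> n = n' /\ y = y'.
Proof.
move=> yn yn' E; have p0 := expn_gt0 2 n; have p1 := expn_gt0 2 n'.
have [nn|nn|nn] := ltngtP n n'.
- by have := leq_pexp2l (isT : 0 < 2) nn; rewrite expnS; lia.
- by have := leq_pexp2l (isT : 0 < 2) nn; rewrite expnS; lia.
- by subst n'; split=> //; lia.
Qed.

(** Semidecision by unbounded search: the function minimized does not depend on the counter, so
    [Min] returns 0 if [D] holds and diverges otherwise. The program then outputs [V]. *)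
Lemma enumerate (D : nat * nat -> bool) (V : nat * nat -> nat) :
  computable D -> computable V ->
  exists c, forall o i x,
    enumerated o c i x <-> exists q, D (i, q) /\ V (i, q) = code_string x.
Proof.
move=> hD [cv hV].
have [cd hcd] : computable (fun x : nat * nat * nat => ~~ D x.1).
  apply: computable_negb; apply: (computable_comp hD); comp.
have [ci hci] := @computable_id (nat * nat) _.
exists (Comp (Comp cv Fst) (Pair ci (Min cd))) => o i x.
have eM q v : eval o (Min cd) (pairn i q) v <-> v = 0 /\ D (i, q).
  split=> [[/(hcd o (i, q, v)) /= Dq hk]|[-> Dq]].
    have {}Dq : D (i, q) by move: Dq; rewrite /enc /=; case: (D _).
    split=> //; case: v hk => // v /(_ 0 isT)[y /(hcd o (i, q, 0))].
    by rewrite /= /enc /= Dq.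
  by split=> //; apply/(hcd o (i, q, 0)); rewrite /= /enc /= Dq.
split=> [[q [u [a [b [/(hci o (i, q)) -> /eM[-> Dq] ->]]] [s -> h]]]|[q [Dq qE]]].
  exists q; split=> //; apply/esym/(hV o (i, q)).
  by move: h; rewrite -/(fstn _) pairnK1.
exists q, (pairn (pairn i q) 0).
  exists (pairn i q), 0; split=> //; last exact/eM.
  exact/(hci o (i, q)).
exists (pairn i q); first by rewrite /= -/(fstn _) pairnK1.
by apply/(hV o (i, q)); rewrite qE.
Qed.

(* The largest 2^i such that the string coded by [y] has a prefix among those
   listed in the i-th set. *)
Definition level (e n z y : nat) : nat :=
  \max_(i < n) exb n (fun k => stage e n z i (prefix_code y k)) * 2 ^ i.

(** Here the first bit is the most significant: over 2^n, this is the dyadic number whose binary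
    digits are the first [n] bits of [z]. *)
Definition numer (n z : nat) : nat := \sum_(j < n) bit z j * 2 ^ (n - j.+1).

(** Over 2^n, the largest probability of the bit [b] among the parameters with an expansion starting
    with the first [n] bits of [z]. *)
Definition weight (n z : nat) (b : bool) : nat :=
  if b then (numer n z).+1 else 2 ^ n - numer n z.

(* The reals whose expansion starts with the [n'] bits of [z'] form the interval
   from [numer n' z' / 2^n'] to [(numer n' z' + 1) / 2^n']; bounding the
   probability of each bit by its maximum there shows that the integral of
   [level e n z] is at most 2 for all [p] in this interval. *)
Definition small (e n z n' z' : nat) : bool :=
  \sum_(y < 2 ^ n) level e n z y * \prod_(j < n) weight n' z' (bit y j)
    <= 2 * 2 ^ (n' * n).

(* With the first [l] bits [y] of the sequence and [z] of the oracle, some program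
   [e] that has not been cut off yet gives a value whose multiple by 2^-(e+1) is
   at least 2^m. *)
Definition hit (m l y z : nat) : bool :=
  exb l (fun e => exb l.+1 (fun n => exb l.+1 (fun n' =>
    [&& n <= n', small e n (z %% 2 ^ n) n' (z %% 2 ^ n')
      & 2 ^ (m + e).+1 <= level e n (z %% 2 ^ n) y]))).

Lemma computable_level {X} {eX : encodable X} (E N Z Y : X -> nat) :
  computable E -> computable N -> computable Z -> computable Y ->
  computable (fun x => level (E x) (N x) (Z x) (Y x)).
Proof.
move=> hE hN hZ hY; rewrite /level /prefix_code.
apply: (computable_comp (F := fun x : nat * nat * nat * nat =>
    \max_(i < x.1.1.2) exb x.1.1.2 (fun k => stage x.1.1.1 x.1.1.2 x.1.2 i
      (x.2 %% 2 ^ k + (2 ^ k).-1)) * 2 ^ i)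
  (G := fun x => (E x, N x, Z x, Y x))); last comp.
apply: (computable_bigmax (F := fun (x : nat * nat * nat * nat) i =>
  exb x.1.1.2 (fun k => stage x.1.1.1 x.1.1.2 x.1.2 i
      (x.2 %% 2 ^ k + (2 ^ k).-1)) * 2 ^ i)); comp.
Qed.
#[local] Hint Resolve computable_level : comp.

Lemma computable_numer {X} {eX : encodable X} (N Z : X -> nat) :
  computable N -> computable Z -> computable (fun x => numer (N x) (Z x)).
Proof.
move=> hN hZ; rewrite /numer.
apply: (computable_fun2 (f := fun n z => \sum_(j < n) bit z j * 2 ^ (n - j.+1))) => //.
apply: (computable_sum (F := fun x j => bit x.2 j * 2 ^ (x.1 - j.+1))); comp.
Qed.
#[local] Hint Resolve computable_numer : comp.

Lemma computable_small :
  computable (fun x : nat * nat * nat * (nat * nat) =>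
    small x.1.1.1 x.1.1.2 x.1.2 x.2.1 x.2.2).
Proof.
rewrite /small /weight; apply: computable_leq; last comp.
apply: (computable_sum (F := fun (x : nat * nat * nat * (nat * nat)) y =>
  level x.1.1.1 x.1.1.2 x.1.2 y * \prod_(j < x.1.1.2)
    if bit y j then (numer x.2.1 x.2.2).+1 else 2 ^ x.2.1 - numer x.2.1 x.2.2)).
  comp.
apply: computable_mul; first comp.
apply: (computable_prod (F := fun (x : nat * nat * nat * (nat * nat) * nat) j =>
  if bit x.2 j then (numer x.1.2.1 x.1.2.2).+1
  else 2 ^ x.1.2.1 - numer x.1.2.1 x.1.2.2)); comp.
Qed.

Lemma computable_hit {X} {eX : encodable X} (M L Y Z : X -> nat) :
  computable M -> computable L -> computable Y -> computable Z ->
  computable (fun x => hit (M x) (L x) (Y x) (Z x)).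
Proof.
move=> hM hL hY hZ.
apply: (computable_comp (F := fun x : nat * nat * nat * nat =>
  hit x.1.1.1 x.1.1.2 x.1.2 x.2)
  (G := fun x => (M x, L x, Y x, Z x))); last comp.
rewrite /hit; do 3 (apply: computable_exb; first comp).
apply: computable_andb; first comp.
apply: computable_andb; last comp.
apply: (computable_comp computable_small (G := fun x : nat * nat * nat * nat * nat * nat * nat =>
  (x.1.1.2, x.1.2, x.1.1.1.2 %% 2 ^ x.1.2, (x.2, x.1.1.1.2 %% 2 ^ x.2)))).
comp.
Qed.
#[local] Hint Resolve computable_hit : comp.

Lemma level_num (w : nat -> bool) e n z l : n <= l ->
  level e n z (prefix_num w l) = level e n z (prefix_num w n).
Proof.
move=> nl; apply: eq_bigr => i _; congr (nat_of_bool _ * _).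
apply: eq_in_has => k; rewrite mem_iota => /andP[_ kn].
by rewrite !prefix_code_num// ltnW// (leq_trans kn).
Qed.

Lemma hitP m l (w o : nat -> bool) :
  reflect (exists e n n', [/\ e < l, n <= n' <= l,
      small e n (prefix_num o n) n' (prefix_num o n') &
      2 ^ (m + e).+1 <= level e n (prefix_num o n) (prefix_num w n)])
    (hit m l (prefix_num w l) (prefix_num o l)).
Proof.
apply: (iffP (exbP _ _)) => [[e el /exbP[n nl /exbP[n' nl' /and3P[nn]]]]|].
  rewrite !num_mod// level_num// => S L; exists e, n, n'; split=> //.
  by rewrite nn.
move=> [e [n [n' [el /andP[nn nl'] S L]]]]; have nl := leq_trans nn nl'.
exists e => //; apply/exbP; exists n => //; apply/exbP; exists n' => //.
by rewrite !num_mod// level_num// nn S.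
Qed.

Lemma hit_mono m l l' (w o : nat -> bool) : l <= l' ->
  hit m l (prefix_num w l) (prefix_num o l) -> hit m l' (prefix_num w l') (prefix_num o l').
Proof.
move=> ll /hitP[e [n [n' [el /andP[nn nl] S L]]]]; apply/hitP.
by exists e, n, n'; split; rewrite // ?nn ?(leq_trans _ ll).
Qed.

Lemma level_le e n z y i : i < n ->
  (exists2 k, k < n & stage e n z i (prefix_code y k)) -> 2 ^ i <= level e n z y.
Proof.
move=> lt_in h; apply: leq_trans (leq_bigmax (Ordinal lt_in)) => /=.
by rewrite (introT (exbP _ _) h) mul1n.
Qed.

Lemma level_gt0 e n z y : 0 < level e n z y ->
  exists i, [/\ i < n, level e n z y = 2 ^ i
    & exists2 k, k < n & stage e n z i (prefix_code y k)].
Proof.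
rewrite /level; elim/big_ind: _ => // [a b ha hb|i _].
  by rewrite /maxn; case: ifP.
by case: exbP => // h _; exists i; split; rewrite ?mul1n.
Qed.

(** * Compactness of the space of oracles *)

Lemma num_bit_mod z n : prefix_num (bit z) n = z %% 2 ^ n.
Proof.
rewrite -(@num_bit (z %% 2 ^ n) n) ?ltn_pmod ?expn_gt0//.
by apply: eq_num => j jn; rewrite bit_mod.
Qed.

(** A number below 2^n stands for a string of [n] bits, and reduction modulo 2^k for truncation. The
    branch is built by keeping to nodes with descendants at every later level. *)
Lemma konig (B : nat -> nat -> Prop) :
  (forall n, exists2 z, z < 2 ^ n & B n z) ->
  (forall n k z, k <= n -> B n z -> B k (z %% 2 ^ k)) ->
  exists o, forall n, B n (prefix_num o n).
Proof.
move=> Bex Bmod.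
pose ext n z := forall N, n <= N -> exists2 z', B N z' & z' %% 2 ^ n = z.
have ext0 : ext 0 0.
  by move=> N _; have [z zN Bz] := Bex N; exists z; rewrite ?modn1.
have extS n z : ext n z -> exists b : bool, ext n.+1 (z + b * 2 ^ n).
  move=> E; apply: contrapT => /boolp.forallNP nE.
  have wit (b : bool) : exists2 N, n < N &
      forall z', B N z' -> z' %% 2 ^ n.+1 <> z + b * 2 ^ n.
    have /boolp.existsNP[N /boolp.not_implyP[nN h]] := nE b.
    by exists N => // z' Bz z'E; apply: h; exists z'.
  have [N1 n1 h1] := wit false; have [N2 n2 h2] := wit true.
  (* At the larger of the levels where the two children of [z] fail, [z] still has a descendant; its
     bit at [n] selects a child that has descendants at both levels, a contradiction. *)
  have [z' Bz z'E] : exists2 z', B (maxn N1 N2) z' & z' %% 2 ^ n = z.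
    by apply: E; rewrite leq_max ltnW.
  have M N : n < N <= maxn N1 N2 -> B N (z' %% 2 ^ N) /\
      z' %% 2 ^ N %% 2 ^ n.+1 = z + bit z' n * 2 ^ n.
    move=> /andP[nN NM]; split; first exact: Bmod Bz.
    by rewrite modn_dvdm ?dvdn_exp2l// -!num_bit_mod num_recr num_bit_mod z'E.
  case b : (bit z' n) M => M.
    have [|B2 E2] := M N2; first by rewrite n2 leq_maxr.
    exact: h2 B2 E2.
  have [|B1 E1] := M N1; first by rewrite n1 leq_maxl.
  exact: h1 B1 E1.
have [f fP] : exists f : nat -> nat -> bool,
    forall n z, ext n z -> ext n.+1 (z + f n z * 2 ^ n).
  have [|f fP] := @boolp.choice (nat * nat) bool
    (fun x b => ext x.1 x.2 -> ext x.1.+1 (x.2 + b * 2 ^ x.1)).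
    move=> [n z]; have [/extS[b bP]|nE] := boolp.pselect (ext n z).
      by exists b.
    by exists false.
  by exists (fun n z => f (n, z)) => n z; exact: (fP (n, z)).
pose zz n := iteri n (fun n z => z + f n z * 2 ^ n) 0.
exists (fun n => f n (zz n)) => n.
have -> : prefix_num (fun n => f n (zz n)) n = zz n.
  by elim: n => [|n IH]; rewrite ?num_recr ?IH//= /prefix_num big_ord0.
have E : ext n (zz n) by elim: n => //= n IH; exact: fP.
have [z' Bz' z'E] := E n (leqnn n).
by rewrite -z'E; exact: Bmod Bz'.
Qed.

(* For [m = 0] nothing is required: a universal test must be bounded below. *)
Definition tested (m : nat) (w : nat -> bool) : Prop :=
  m = 0 \/ forall o, exists l, hit m l (prefix_num w l) (prefix_num o l).

(** If no length [l] works, the oracle strings without a hit form an infinite tree, closed under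
    truncation by [hit_mono]; an infinite branch is an oracle that never hits. *)
Lemma tested_compact m w : tested m w <->
  exists l, (m == 0) || allb (2 ^ l) (hit m l (prefix_num w l)).
Proof.
split=> [[->|h]|[l /orP[/eqP ->|/allbP h]]]; last 2 first.
- by left.
- by right=> o; exists l; apply: h; exact: num_lt.
- by exists 0.
apply: contrapT => /boolp.forallNP nh.
have [||o oP] := @konig (fun n z => z < 2 ^ n /\ ~~ hit m n (prefix_num w n) z).
- move=> n; apply: contrapT => h'; apply: (nh n); apply/orP; right.
  apply/allbP => z zn; apply: contrapT => /negP hz; apply: h'.
  by exists z.
- move=> n k z kn [zn]; rewrite -(num_bit zn) num_mod// => nhit; split; first exact: num_lt.
  by apply: contra nhit => /hit_mono; exact.
by have [l hl] := h o; have [_ /negP] := oP l.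
Qed.

(** With [k] coding the rational (a - b) / (d + 1), the first condition says that it is less than
    2^m / 4, with denominators cleared. *)
Lemma enumerate_tested : exists c, forall o k x, enumerated o c k x <->
  exists m, [/\ 4 * fstn (fstn k) < 4 * sndn (fstn k) + 2 ^ m * (sndn k).+1 &
    (m == 0) || allb (2 ^ size x) (hit m (size x) (prefix_num (nth false x) (size x)))].
Proof.
(* The search index codes [m], the length [l] of the string and its bits [y]. *)
pose D (x : nat * nat) := let m := fstn x.2 in let l := fstn (sndn x.2) in
  let y := sndn (sndn x.2) in
  [&& 4 * fstn (fstn x.1) < 4 * sndn (fstn x.1) + 2 ^ m * (sndn x.1).+1,
    y < 2 ^ l & (m == 0) || allb (2 ^ l) (hit m l y)].
have [||c cP] := @enumerate D
  (fun x => sndn (sndn x.2) + (2 ^ fstn (sndn x.2)).-1).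
- rewrite /D; comp.
- comp.
exists c => o k x; rewrite cP /D /= => {cP D}.
have -> : code_string x = prefix_num (nth false x) (size x) + (2 ^ size x).-1.
  by rewrite -code_string_mkseq mkseq_nth.
split=> [[q [/and3P[h1 h2 h3]]]|[m [h1 h2]]].
  move=> /(code_string_uniq h2 (num_lt _ _))[lE yE]; rewrite yE lE in h3.
  by exists (fstn q); split; [exact: h1|exact: h3].
exists (pairn m (pairn (size x) (prefix_num (nth false x) (size x)))).
by rewrite !(pairnK1, pairnK2) num_lt h1 h2.
Qed.

(** * Expansions and finite-dependence integrals *)

Local Open Scope classical_set_scope.
Local Open Scope ring_scope.

Section expansion.
Context {R : realType}.
Implicit Types (p : R) (o : nat -> bool).

Local Notation approx o := (series (fun n => (o n)%:R / 2 ^+ n.+1 : R)).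

Lemma exprV2S n : 2 ^- n = 2 * 2 ^- n.+1 :> R.
Proof. by rewrite exprS invfM mulrA mulfV ?pnatr_eq0// mul1r. Qed.

Lemma approx0 o : approx o 0 = 0.
Proof. by rewrite /series /= big_geq. Qed.

Lemma approxS o n : approx o n.+1 = approx o n + (o n)%:R / 2 ^+ n.+1.
Proof. by rewrite /series /= big_nat_recr. Qed.

Lemma approx_itv o n k :
  approx o n <= approx o (n + k)%N <= approx o n + (2 ^- n - 2 ^- (n + k)).
Proof.
elim: k => [|k /andP[h1 h2]]; first by rewrite addn0 subrr addr0 lexx.
rewrite addnS approxS.
have : 2 ^- (n + k) = 2 * 2 ^- (n + k).+1 :> R.
  exact: exprV2S.
move: h1 h2; have : 0 < 2 ^- (n + k).+1 :> R by rewrite invr_gt0 exprn_gt0.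
set a := 2 ^- (n + k).+1 => a0 h1 h2 h.
by apply/andP; split; case: (o (n + k)%N); rewrite /= ?mul1r ?mul0r; lra.
Qed.

Lemma expansion_itv p o n : binary_expansion p o ->
  approx o n <= p <= approx o n + 2 ^- n.
Proof.
move=> op; apply/andP; split.
  apply: (cvgr_to_ge op); exists n => // m /= nm.
  by rewrite -(subnKC nm); case/andP: (approx_itv o n (m - n)).
apply: (cvgr_to_le op); exists n => // m /= nm.
rewrite -(subnKC nm); case/andP: (approx_itv o n (m - n)) => _ /le_trans; apply.
by rewrite lerD2l gerBl invr_ge0 exprn_ge0.
Qed.

Lemma cvg_half : (2 ^- n : R) @[n --> \oo] --> 0.
Proof.
have -> : (fun n => 2 ^- n : R) = GRing.exp 2^-1 by apply/funext => n; rewrite exprVn.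
by apply: cvg_expr; rewrite gtr0_norm ?invr_gt0// invf_lt1// ltr1n.
Qed.

Lemma expansion_ex p : 0 <= p <= 1 -> exists o, binary_expansion p o.
Proof.
(* The doubling map on the closed unit interval yields the digits; for [p] = 1 they are all 1. *)
move=> p01; pose step (x : R) := 2 * x - (1 <= 2 * x)%R%:R.
pose o n : bool := 1 <= 2 * iter n step p.
have h n : 0 <= iter n step p <= 1 /\ approx o n = p - iter n step p * 2 ^- n.
  elim: n => [|n [x01 E]].
    by rewrite expr0 invr1 mulr1 subrr approx0.
  rewrite approxS E /o /=; set x := iter n step p in x01 *.
  have -> : 2 ^- n = 2 * 2 ^- n.+1 :> R.
    exact: exprV2S.
  rewrite /step; set a := 2 ^- n.+1.
  case: (leP 1 (2 * x)) => h; split; rewrite /= ?mulr1n ?mulr0n; try by ring.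
    by move/andP: x01 => [x0 x1]; apply/andP; split; lra.
  by move/andP: x01 => [x0 x1]; apply/andP; split; lra.
exists o; rewrite /binary_expansion.
have -> : approx o = (fun n => p - iter n step p * 2 ^- n).
  by apply/funext => n; have [_ ->] := h n.
rewrite -[X in _ --> X]subr0; apply: cvgB; first exact: cvg_cst.
apply: (squeeze_cvgr _ (cvg_cst 0) cvg_half).
apply: nearW => n; have [/andP[x0 x1] _] := h n.
rewrite mulr_ge0 ?invr_ge0 ?exprn_ge0//= ler_piMl// invr_ge0 exprn_ge0//.
Qed.

Lemma expansion_cvg o : exists2 p : R, 0 <= p <= 1 & binary_expansion p o.
Proof.
have cv : cvgn (approx o).
  apply: nondecreasing_is_cvgn.
    move=> n m nm; rewrite -(subnKC nm).
    by case/andP: (approx_itv o n (m - n)).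
  exists 1 => _ [n _ <-]; case/andP: (approx_itv o 0 n) => _.
  have : 0 <= 2 ^- (0 + n) :> R by rewrite invr_ge0 exprn_ge0.
  by rewrite approx0 expr0 invr1; lra.
exists (limn (approx o)) => //.
have := expansion_itv 0 cv; by rewrite approx0 add0r expr0 invr1.
Qed.

Lemma numer_approx o n : (numer n (prefix_num o n))%:R / 2 ^+ n = approx o n.
Proof.
rewrite /series /= /numer natr_sum mulr_suml big_mkord; apply: eq_bigr => j _.
rewrite bit_num ltn_ord /= natrM natrX -mulrA; congr (_ * _).
by rewrite -[in X in _ / X](subnK (ltn_ord j)) exprD invfM mulrA mulfV ?mul1r// expf_neq0// pnatr_eq0.
Qed.

Definition bitp (p : R) (b : bool) : R := if b then p else 1 - p.

Lemma bitp_ge0 p b : 0 <= p <= 1 -> 0 <= bitp p b.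
Proof. by move=> /andP[p0 p1]; case: b; rewrite //= subr_ge0. Qed.

Lemma weight_itv p o n b : 0 <= p <= 1 -> binary_expansion p o ->
  bitp p b <= (weight n (prefix_num o n) b)%:R / 2 ^+ n <= bitp p b + 2 ^- n.
Proof.
move=> p01 /(expansion_itv n); rewrite -numer_approx.
set N := numer _ _ => /andP[h1 h2].
have p2 : 0 < 2 ^+ n :> R by rewrite exprn_gt0.
(* So the truncated subtraction in [weight] is exact. *)
have N2 : (N <= 2 ^ n)%N.
  rewrite -(ler_nat R) natrX -[leRHS]mul1r -ler_pdivrMr//.
  by apply: le_trans h1 _; case/andP: p01.
case: b; rewrite /bitp /weight -/N.
  by rewrite -addn1 natrD mulrDl mul1r; lra.
by rewrite natrB// natrX mulrBl mulfV ?gt_eqF//; lra.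
Qed.

(** The probability under B_p of the cylinder given by the first [n] bits of [y]. *)
Definition bprob p (n y : nat) : R := \prod_(j < n) bitp p (bit y j).

(** By [weight_itv] the sum in [small], over the common denominator 2^(n' * n), dominates the
    integral of the level. *)
Lemma small_bound p o e n n' : 0 <= p <= 1 -> binary_expansion p o ->
  small e n (prefix_num o n) n' (prefix_num o n') ->
  \sum_(y < 2 ^ n) (level e n (prefix_num o n) y)%:R * bprob p n y <= 2.
Proof.
move=> p01 op; rewrite /small => h.
have p2 : 0 < 2 ^+ (n' * n) :> R by rewrite exprn_gt0.
apply: (@le_trans _ _ ((\sum_(y < 2 ^ n) level e n (prefix_num o n) y *
    \prod_(j < n) weight n' (prefix_num o n') (bit y j))%N%:R / 2 ^+ (n' * n))).
  rewrite natr_sum mulr_suml; apply: ler_sum => y _.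
  rewrite natrM -mulrA ler_wpM2l// natr_prod exprM -[n in X in _ / X]card_ord.
  rewrite -prodr_const -prodf_div; apply: ler_prod => j _.
  by rewrite bitp_ge0//=; case/andP: (weight_itv n' (bit y j) p01 op).
by rewrite ler_pdivrMr// -natrX -natrM ler_nat.
Qed.

(** As more bits of the oracle are read, the upper estimates tend to the true integral. Being at
    most 1, it leaves room below the threshold 2, so that the level is eventually certified. *)
Lemma small_ex p o e n : 0 <= p <= 1 -> binary_expansion p o ->
  \sum_(y < 2 ^ n) (level e n (prefix_num o n) y)%:R * bprob p n y <= 1 ->
  exists2 n', (n <= n')%N & small e n (prefix_num o n) n' (prefix_num o n').
Proof.
move=> p01 op le1.
pose F k : R := \sum_(y < 2 ^ n) (level e n (prefix_num o n) y)%:R *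
  \prod_(j < n) (bitp p (bit y j) + 2 ^- k).
have cF : F k @[k --> \oo] -->
    \sum_(y < 2 ^ n) (level e n (prefix_num o n) y)%:R * bprob p n y.
  apply: cvg_big; first exact: add_continuous.
  move=> y _; apply: cvgMr.
  apply: cvg_big; first exact: mul_continuous.
  move=> j _; rewrite -[X in _ --> X]addr0; apply: cvgD; first exact: cvg_cst.
  exact: cvg_half.
have [N _ FN] := cvgr_le _ cF _ (le_lt_trans le1 (ltr1n R 2)).
exists (maxn n N); first exact: leq_maxl.
have /= {FN} := FN (maxn n N) (leq_maxr _ _); set n' := maxn n N => F2.
have p2 : 0 < 2 ^+ (n' * n) :> R by rewrite exprn_gt0.
rewrite /small -(ler_nat R) natrM natrX -ler_pdivrMr//.
apply: le_trans F2; rewrite natr_sum mulr_suml; apply: ler_sum => y _.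
rewrite natrM -mulrA ler_wpM2l// natr_prod exprM -[n in X in _ / X]card_ord.
rewrite -prodr_const -prodf_div; apply: ler_prod => j _.
by rewrite divr_ge0 ?exprn_ge0//=; case/andP: (weight_itv n' (bit y j) p01 op).
Qed.

End expansion.

(* Unlike [ge0_le_integral], this needs no measurability. *)
Lemma ge0_integral_mono d (T : measurableType d) (R : realType)
    (mu : {measure set T -> \bar R}) (f g : T -> \bar R) :
  (forall x, 0 <= f x)%E -> (forall x, f x <= g x)%E ->
  (\int[mu]_x f x <= \int[mu]_x g x)%E.
Proof.
move=> f0 fg; rewrite !ge0_integralTE//; last first.
  by move=> x; exact: le_trans (fg x).
apply: ereal_sup_le => _ [h hf <-]; exists h => // x.
exact: le_trans (fg x).
Qed.

(** * Integrals of functions of finitely many bits *)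

Lemma measurable_cylinder x : measurable (cylinder x : set Omega).
Proof. by apply: sub_sigma_algebra; exists x. Qed.

Lemma cylinder_num n y : (y < 2 ^ n)%N ->
  cylinder (mkseq (bit y) n) = [set w | prefix_num w n = y].
Proof.
move=> yn; apply/seteqP; split=> w; rewrite /cylinder /= size_mkseq.
  move=> E; rewrite -(num_bit yn); apply: eq_num => j jn.
  by have := congr1 (fun s => nth false s j) E; rewrite !nth_mkseq.
move=> <-; apply/eq_in_map => j; rewrite mem_iota => jn.
by rewrite bit_num; move: jn => /= ->.
Qed.

Section finite_dependence.
Context {R : realType}.
Implicit Types (g : nat -> R) (w : Omega).

Lemma measurable_indic_cylinder x :
  measurable_fun [set: Omega] (fun w : Omega => (\1_(cylinder x) w : R)%:E).
Proof. by apply/measurable_EFinP; exact: measurable_indic (measurable_cylinder x). Qed.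

Lemma num_indic g n w : (g (prefix_num w n))%:E =
  (\sum_(y < 2 ^ n) (g y)%:E * (\1_(cylinder (mkseq (bit y) n)) w)%:E)%E.
Proof.
rewrite (bigD1 (Ordinal (num_lt w n)))//= big1 ?adde0 => [|y yw].
  by rewrite cylinder_num ?num_lt// indicE mem_set// mule1.
rewrite indicE memNset ?mule0// cylinder_num//= => E; move/eqP: yw; apply.
exact: val_inj.
Qed.

Lemma measurable_num g n :
  measurable_fun [set: Omega] (EFin \o (fun w => g (prefix_num w n))).
Proof.
have -> : EFin \o (fun w => g (prefix_num w n)) =
    fun w : Omega => (\sum_(y < 2 ^ n) (g y)%:E * (\1_(cylinder (mkseq (bit y) n)) w)%:E)%E.
  by apply/funext => w; exact: num_indic.
apply: emeasurable_sum => y.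
apply: emeasurable_funM; first exact: measurable_cst.
exact: measurable_indic_cylinder.
Qed.

Lemma integral_num (p : R) g n : 0 <= p <= 1 -> (forall y, 0 <= g y) ->
  (\int[bernoulli_measure p]_w (g (prefix_num w n))%:E =
   (\sum_(y < 2 ^ n) g y * bprob p n y)%:E)%E.
Proof.
move=> p01 g0; under eq_integral do rewrite num_indic.
rewrite ge0_integral_sum//; last 2 first.
- move=> y; apply: emeasurable_funM; first exact: measurable_cst.
  exact: measurable_indic_cylinder.
- by move=> y w _; rewrite mule_ge0 ?lee_fin.
rewrite -sumEFin; apply: eq_bigr => y _.
rewrite ge0_integralZl_EFin//; last exact: measurable_indic_cylinder.
rewrite integral_indic// ?setIT; last exact: measurable_cylinder.
rewrite EFinM; congr (_ * _)%E.
apply: etrans (bernoulli_measure_cylinder _ p01) _; congr EFin.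
by rewrite /mkseq big_map /bprob -(big_mkord xpredT (fun j => bitp p (bit y j)))
  /index_iota subn0.
Qed.

End finite_dependence.

(** * Growth of the levels *)

Lemma prefix_code_stage (w o : nat -> bool) e n i :
  (exists2 k, (k < n)%N & stage e n (prefix_num o n) i (prefix_code (prefix_num w n) k)) ->
  exists k, stage e n (prefix_num o n) i (code_string (mkseq w k)).
Proof. by move=> [k kn]; rewrite prefix_code_num 1?ltnW//; exists k. Qed.

Lemma leq_code_string (x : seq bool) : (size x <= code_string x)%N.
Proof. by elim: x => //= b x IH; lia. Qed.

(** A string is no longer than its code, which is below [n] by [stage_lt], so this prefix lies in
    the range that [level] searches. *)
Lemma stage_level (w o : nat -> bool) e n i k :
  stage e n (prefix_num o n) i (code_string (mkseq w k)) ->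
  (2 ^ i <= level e n (prefix_num o n) (prefix_num w n))%N.
Proof.
move=> h; have /andP[lt_in lt_vn] := stage_lt h.
have kn : (k < n)%N.
  by apply: leq_ltn_trans lt_vn; rewrite -{1}(size_mkseq w k) leq_code_string.
by apply: level_le => //; exists k => //; rewrite prefix_code_num// ltnW.
Qed.

Lemma level_mono (w o : nat -> bool) e n n' : (n <= n')%N ->
  (level e n (prefix_num o n) (prefix_num w n) <= level e n' (prefix_num o n') (prefix_num w n'))%N.
Proof.
move=> nn; have [->//|/level_gt0[i [_ -> /prefix_code_stage[k h]]]] :=
  posnP (level e n (prefix_num o n) (prefix_num w n)).
exact: stage_level (stage_prefix nn h).
Qed.

(* The longest prefix of the oracle at which program [e] is known, from [l] bits
   of the oracle, not to be cut off. *)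
Definition best (e l : nat) (o : nat -> bool) : nat :=
  \max_(n < l.+1 | exb l.+1 (fun n' => (n <= n')%N &&
    small e n (prefix_num o n) n' (prefix_num o n'))) n.

Lemma bestP e l o : (best e l o <= l)%N /\ (best e l o = 0%N \/
  exists n', small e (best e l o) (prefix_num o (best e l o)) n' (prefix_num o n')).
Proof.
rewrite /best; elim/big_ind: _ => [|a b ha hb|n /exbP[n' _ /andP[_ h]]].
- by split; [|left].
- by rewrite /maxn; case: ifP.
- by split; [rewrite -ltnS|right; exists n'].
Qed.

Lemma best_max e l o n n' : (n <= n' <= l)%N -> small e n (prefix_num o n) n' (prefix_num o n') ->
  (n <= best e l o)%N.
Proof.
move=> /andP[nn nl] h; have nl' : (n < l.+1)%N by rewrite ltnS (leq_trans nn).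
apply: (@leq_bigmax_cond _ _ _ (Ordinal nl')) => /=.
by apply/exbP; exists n' => //; rewrite nn.
Qed.

Lemma best_mono e l l' o : (l <= l')%N -> (best e l o <= best e l' o)%N.
Proof.
move=> ll; rewrite {1}/best; apply/bigmax_leqP => n /exbP[n' nl /andP[nn h]].
by apply: best_max h; rewrite nn (leq_trans _ ll).
Qed.

(** * The test and its integral *)

Section bernoulli.
Context {R : realType}.

(** A sum over programs dominates the largest weighted value and is easy to integrate. For an
    expansion [o] of the parameter each trimmed level has integral at most 2, so with the factors
    2^-(e+3) the sum contributes less than 1/2; the constant 4^-1 accounts for [m] = 0 in
    [tested]. *)
Definition combined (o : nat -> bool) (l y : nat) : R :=
  4^-1 + \sum_(e < l) (level e (best e l o) (prefix_num o (best e l o)) y)%:R * 2 ^- (e + 3).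

Lemma combined_ge o l y : 4^-1 <= combined o l y.
Proof. by rewrite lerDl sumr_ge0. Qed.

Lemma combined_mono o l l' (w : nat -> bool) : (l <= l')%N ->
  combined o l (prefix_num w l) <= combined o l' (prefix_num w l').
Proof.
move=> ll; rewrite /combined lerD2l -(subnKC ll) big_split_ord /= (subnKC ll).
rewrite -[leLHS]addr0 lerD//; last first.
  by apply: sumr_ge0 => e _; rewrite mulr_ge0 ?invr_ge0 ?exprn_ge0.
apply: ler_sum => e _; rewrite ler_wpM2r ?invr_ge0 ?exprn_ge0// ler_nat.
have [b1 _] := bestP e l o; have [b2 _] := bestP e l' o.
by rewrite (level_num w _ _ b1) (level_num w _ _ b2) level_mono// best_mono.
Qed.

Lemma hit_combined m l (w o : nat -> bool) : hit m l (prefix_num w l) (prefix_num o l) ->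
  2 ^+ m / 4 <= combined o l (prefix_num w l).
Proof.
move=> /hitP[e [n [n' [el nn S L]]]].
have nb := best_max nn S; have [bl _] := bestP e l o.
rewrite /combined (bigD1 (Ordinal el))//= addrCA.
(* The term of [e] alone suffices, since 2^(m+e+1) * 2^-(e+3) = 2^m / 4. *)
apply: (@le_trans _ _ ((2 ^ (m + e).+1)%N%:R * 2 ^- (e + 3))); last first.
  rewrite -[leLHS]addr0 lerD//.
    rewrite ler_wpM2r ?invr_ge0 ?exprn_ge0// ler_nat (leq_trans L)//.
    by rewrite (level_num w _ _ bl) level_mono.
  by rewrite addr_ge0// ?invr_ge0// sumr_ge0.
rewrite natrX -addnS !exprD !exprS expr0.
by rewrite le_eqVlt; apply/orP; left; apply/eqP; field; rewrite expf_neq0.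
Qed.

Lemma level_small_le (p : R) o e l : 0 <= p <= 1 -> binary_expansion p o ->
  \sum_(y < 2 ^ l) (level e (best e l o) (prefix_num o (best e l o)) y)%:R * bprob p l y <= 2.
Proof.
move=> p01 op; have [bl] := bestP e l o; set n := best e l o in bl *.
(* Going through the integral reduces the sum over [l] bits to one over the [n] bits that the level
   reads. *)
rewrite -lee_fin -(integral_num (g := fun y => (level e n (prefix_num o n) y)%:R))//.
under eq_integral do rewrite level_num//.
rewrite (integral_num (g := fun y => (level e n (prefix_num o n) y)%:R))// lee_fin.
case=> [->|[n' h]]; last exact: small_bound h.
by rewrite big1// => y _; rewrite /level big_ord0 mul0r.
Qed.

Lemma integral_combined (p : R) o l : 0 <= p <= 1 -> binary_expansion p o ->
  (\int[bernoulli_measure p]_w (combined o l (prefix_num w l))%:E <= 1)%E.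
Proof.
move=> p01 op; rewrite integral_num//; last first.
  by move=> y; rewrite (le_trans _ (combined_ge o l y))// invr_ge0.
rewrite lee_fin; under eq_bigr do rewrite /combined mulrDl mulr_suml.
rewrite big_split /= exchange_big /= -mulr_sumr.
have -> : \sum_(y < 2 ^ l) bprob p l y = 1.
  apply: EFin_inj; have := @integral_num R p (fun=> 1) l p01 (fun=> ler01).
  under [in RHS]eq_bigr do rewrite mul1r.
  by rewrite integral_cst// mul1e => <-; exact: probability_setT.
apply: (@le_trans _ _ (4^-1 * 1 + \sum_(e < l) 2 * 2 ^- (e + 3))).
  rewrite lerD2l; apply: ler_sum => e _.
  under eq_bigr do rewrite mulrAC.
  rewrite -mulr_suml ler_wpM2r ?invr_ge0 ?exprn_ge0//.
  exact: level_small_le.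
have -> : \sum_(e < l) 2 * 2 ^- (e + 3) = 2^-1 * (1 - 2 ^- l) :> R.
  elim: (l) => [|k IH]; first by rewrite big_ord0 expr0 invr1 subrr mulr0.
  rewrite big_ord_recr IH /= addn3 !exprS.
  by field; rewrite expf_neq0.
have : 0 <= 2 ^- l :> R by rewrite invr_ge0 exprn_ge0.
by lra.
Qed.

(** Requiring 2^m from every oracle and then taking the supremum gives the infimum over oracles; the
    factor 4^-1 leaves room for the estimate by [combined]. *)
Definition btest (w : Omega) : \bar R :=
  ereal_sup [set (2 ^+ m / 4)%:E | m in [set m | tested m w]].

Lemma btest_ge m w : tested m w -> ((2 ^+ m / 4)%:E <= btest w)%E.
Proof. by move=> h; apply: ereal_sup_ubound; exists m. Qed.

Lemma btest_ge0 w : (0 <= btest w)%E.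
Proof.
apply: le_trans (btest_ge (m := 0) _); last by left.
by rewrite lee_fin mulr_ge0// invr_ge0.
Qed.

(** For one expansion [o] of [p], [btest] lies below the increasing limit of [combined o], whose
    integral is bounded by monotone convergence. *)
Lemma integral_btest (p : R) : 0 <= p <= 1 ->
  (\int[bernoulli_measure p]_w btest w <= 1)%E.
Proof.
move=> p01; case: (expansion_ex p01) => o op.
have nd (w : Omega) : {homo (fun l => (combined o l (prefix_num w l))%:E) :
    m n / (m <= n)%N >-> (m <= n)%E}.
  by move=> m n mn; rewrite lee_fin combined_mono.
pose H (w : Omega) := limn (fun l => (combined o l (prefix_num w l))%:E).
have H_ge w l : ((combined o l (prefix_num w l))%:E <= H w)%E.
  rewrite /H (cvg_lim _ (ereal_nondecreasing_cvgn (nd w)))//.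
  by apply: ereal_sup_ubound; exists l.
have c0 l y : 0 <= combined o l y.
  by rewrite (le_trans _ (combined_ge o l y))// invr_ge0.
apply: (@le_trans _ _ (\int[bernoulli_measure p]_w H w)%E).
  apply: ge0_integral_mono; first exact: btest_ge0.
  move=> w; apply: ge_ereal_sup => _ [m [->|/(_ o)[l h]] <-].
    by rewrite expr0 mul1r (le_trans _ (H_ge w 0))// lee_fin combined_ge.
  by rewrite (le_trans _ (H_ge w l))// lee_fin hit_combined.
rewrite /H monotone_convergence//.
- apply: lime_le.
    apply: ereal_nondecreasing_is_cvgn => m n mn.
    apply: ge0_integral_mono => w; first by rewrite lee_fin.
    exact: nd.
  by apply: nearW => l; exact: integral_combined.
- by move=> l; exact: measurable_num.
- by move=> l w _; rewrite lee_fin.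
Qed.

End bernoulli.

(** * Universality and randomness *)

(** Since [no_oracle] always answers 0, replacing [Oracle] by [Zero] gives a program that behaves
    the same for every oracle. *)
Lemma deoracle c : exists c', forall o a v, eval o c' a v <-> eval no_oracle c a v.
Proof.
elim: c => [| | | | |f [f' hf] g [g' hg]|f [f' hf] g [g' hg]|f [f' hf] g [g' hg]|f [f' hf]].
- by exists Zero.
- by exists Succ.
- by exists Fst.
- by exists Snd.
- by exists Zero.
- exists (Pair f' g') => o a v /=; split=> -[y [z [h1 h2 ->]]];
    by exists y, z; split=> //; [apply/(hf o)|apply/(hg o)].
- exists (Comp f' g') => o a v /=; split=> -[y h1 h2];
    by exists y; [apply/(hg o)|apply/(hf o)].
- exists (Prec f' g') => o a v /=; split=> -[x [n [s [h1 h2 h3 h4]]]];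
    by exists x, n, s; split=> // [|k kn]; [apply/(hf o)|apply/(hg o); apply: h3].
- exists (Min f') => o a v /=; split=> -[h1 h2]; split=> [|k /h2[y h]];
    by [apply/(hf o)|exists y; apply/(hf o)].
Qed.

Lemma reindex c (f : nat -> nat) : computable f ->
  exists c', forall o i, enumerated o c' i = enumerated o c (f i).
Proof.
move=> [cf hf]; exists (Comp c (Pair (Comp cf Fst) Snd)) => o i.
apply/seteqP; split=> x [n].
  move=> [u [a [b [[y ->]]]]]; rewrite -/(fstn _) pairnK1 => /(hf o i) -> -> ->.
  by rewrite -/(sndn _) pairnK2 => h; exists n.
move=> h; exists n; exists (pairn (f i) n) => //.
exists (f i), n; split=> //; last by rewrite /= -/(sndn _) pairnK2.
by exists i; [rewrite /= -/(fstn _) pairnK1|exact/(hf o i)].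
Qed.

Lemma enumerated_level (o w : nat -> bool) c n :
  (0 < level (index c) n (prefix_num o n) (prefix_num w n))%N ->
  exists i x, [/\ (i < n)%N, level (index c) n (prefix_num o n) (prefix_num w n) = (2 ^ i)%N,
    enumerated o c i x & cylinder x w].
Proof.
move=> /level_gt0[i [lt_in -> /prefix_code_stage[k h]]].
exists i, (mkseq w k); split=> //; last by rewrite /cylinder /= size_mkseq.
by apply/stageP; exists n.
Qed.

Section universal.
Context {R : realType}.

(** The bound on the integrals ensures, by [small_ex], that the stage listing [x] is not cut off.
    With e the number of the program, the index m + e + 1 compensates for the weight 2^-(e+1). *)
Lemma listed_hit (p : R) (o w : nat -> bool) c m x :
  0 <= p <= 1 -> binary_expansion p o ->
  (forall n, (\int[bernoulli_measure p]_w
    ((level (index c) n (prefix_num o n) (prefix_num w n))%:R : R)%:E <= 1)%E) ->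
  enumerated o c (m + index c).+1 x -> cylinder x w ->
  exists l, hit m l (prefix_num w l) (prefix_num o l).
Proof.
move=> p01 op I h wx; have [n S] := (stageP o c _ (code_string x)).2 h.
have [|n' nn sm] := small_ex (e := index c) (n := n) p01 op.
  move: (I n).
  by rewrite (integral_num (g := fun y => (level (index c) n (prefix_num o n) y)%:R)).
exists (maxn n' (index c).+1); apply/hitP; exists (index c), n, n'; split=> //.
- exact: leq_maxr.
- by rewrite nn leq_maxl.
- by apply: (@stage_level _ _ _ _ _ (size x)); rewrite [mkseq _ _]wx.
Qed.

Lemma rat_of_natE k : rat_of_nat k =
  ((fstn (fstn k))%:R - (sndn (fstn k))%:R) / (sndn k).+1%:R.
Proof.
rewrite /rat_of_nat /fstn /sndn; case: (Cantor.of_nat k) => m d /=.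
by case: (Cantor.of_nat m).
Qed.

Lemma ratr_lt k m : (ratr (rat_of_nat k) < 2 ^+ m / 4 :> R) =
  (4 * fstn (fstn k) < 4 * sndn (fstn k) + 2 ^ m * (sndn k).+1)%N.
Proof.
rewrite rat_of_natE fmorph_div rmorphB /= !ratr_nat ltr_pdivrMr ?ltr0n//.
rewrite -(ltr_nat R) natrD !natrM natrX mulrAC.
by set q := 2 ^+ m * _; apply/idP/idP; lra.
Qed.

Lemma lower_semicomputable_btest : lower_semicomputable (@btest R).
Proof.
have [c cP] := enumerate_tested; exists c => k; apply/seteqP; split=> w /=.
  move=> /ereal_sup_gt[_ [m tm <-]]; rewrite lte_fin ratr_lt => km.
  have [l hl] := (tested_compact m w).1 tm.
  exists (mkseq w l); last by rewrite /cylinder /= size_mkseq.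
  apply/cP; exists m; split; first exact: km.
  rewrite size_mkseq (@eq_num _ w)//.
  by move=> j jl; rewrite nth_mkseq.
move=> [x /cP[m [km hx]] wx]; apply: lt_le_trans (btest_ge (m := m) _).
  by rewrite lte_fin ratr_lt.
apply/tested_compact; exists (size x); rewrite (@eq_num _ (nth false x))//.
by move=> j jx; rewrite -[x in RHS]wx nth_mkseq.
Qed.

Lemma lower_semicomputable_pow (t : Omega -> \bar R) : lower_semicomputable t ->
  exists c, forall o i, [set w | ((2 ^+ i : R)%:E < t w)%E] =
    \bigcup_(x in enumerated o c i) cylinder x.
Proof.
move=> [c0 h0]; have [c1 h1] := deoracle c0.
(* The number 2^i is coded as (2^i - 0) / (0 + 1). *)
have [|c h] := @reindex c1 (fun i => pairn (pairn (2 ^ i) 0) 0); first by comp.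
exists c => o i; rewrite h.
have -> : enumerated o c1 (pairn (pairn (2 ^ i) 0) 0) =
    enumerated no_oracle c0 (pairn (pairn (2 ^ i) 0) 0).
  by apply/seteqP; split=> x [n /h1]; exists n.
rewrite -h0 rat_of_natE !(pairnK1, pairnK2) subr0 divr1.
by rewrite ratr_nat natrX.
Qed.

Lemma level_le_test (t : Omega -> \bar R) c o : (forall w, 0 <= t w)%E ->
  (forall i, [set w | ((2 ^+ i : R)%:E < t w)%E] =
    \bigcup_(x in enumerated o c i) cylinder x) ->
  forall n w, (((level (index c) n (prefix_num o n) (prefix_num w n))%:R : R)%:E <= t w)%E.
Proof.
move=> t0 tE n w; have [->//|/enumerated_level[i [x [_ -> ix wx]]]] :=
  posnP (level (index c) n (prefix_num o n) (prefix_num w n)).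
rewrite natrX ltW//.
have : (\bigcup_(x in enumerated o c i) cylinder x) w by exists x.
by rewrite -tE.
Qed.

Lemma pow2_gt (b : R) : exists m, b < 2 ^+ m / 4.
Proof.
exists (Num.truncn (4 * b)).+1; rewrite ltr_pdivlMr// mulrC.
apply: lt_trans (truncnS_gt _) _.
by rewrite -natrX ltr_nat ltn_expl.
Qed.

Lemma btest_universal : universal_bernoulli_test (@btest R).
Proof.
split.
  split; [exact: btest_ge0|exact: lower_semicomputable_btest|].
  by move=> p; exact: integral_btest.
move=> t [t0 /lower_semicomputable_pow[c cP] tI]; pose e := index c.
(* Every oracle expands some parameter, for which [t] has integral at most 1; so the program of [t]
   reaches 2^m against each oracle. *)
have T m w : ((2 ^+ (m + e).+1 : R)%:E < t w)%E -> tested m w.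
  move=> mt; right=> o; have [p p01 op] := expansion_cvg (R := R) o.
  have [x ix wx] : (\bigcup_(x in enumerated o c (m + e).+1) cylinder x) w.
    by rewrite -cP.
  apply: (listed_hit p01 op _ ix wx) => n; apply: le_trans (tI p p01).
  apply: ge0_integral_mono => w'; first by rewrite lee_fin.
  exact: level_le_test.
(* Let b be the value of [btest], with 2^m / 4 <= b < 2^(m+1) / 4. If [t w] exceeded 2^(e+4) b, it
   would exceed 2^((m+1)+e+1), so [T] would make m + 1 tested and b at least 2^(m+1) / 4. *)
exists (2 ^+ (e + 4)); first by rewrite exprn_gt0.
move=> w; rewrite leNgt; apply/negP => tw.
have bfin : @btest R w \is a fin_num.
  rewrite ge0_fin_numE ?btest_ge0// ltey; apply/eqP => bE.
  by move: tw; rewrite bE gt0_muley ?lte_fin ?exprn_gt0// ltNge leey.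
rewrite -(fineK bfin) -EFinM in tw; set b := fine (btest w) in tw.
have le_b m : tested m w -> 2 ^+ m / 4 <= b.
  by move=> /(btest_ge (R := R)); rewrite -(fineK bfin) lee_fin.
have [m bm min_m] := ex_minnP (pow2_gt b).
case: m bm min_m => [|m] bm min_m.
  by have := le_b 0 (or_introl erefl); rewrite leNgt bm.
have mb : 2 ^+ m / 4 <= b.
  by rewrite leNgt; apply/negP => /min_m; rewrite ltnn.
have : tested m.+1 w.
  apply: T; apply: le_lt_trans tw; rewrite lee_fin.
  rewrite addSn !exprS !exprD.
  have e0 : 0 < 2 ^+ e :> R by rewrite exprn_gt0.
  by move: mb e0; set u := 2 ^+ m; set v := 2 ^+ e; nra.
by move=> /le_b; rewrite leNgt bm.
Qed.

Lemma measurable_effectively_open o (U : nat -> set Omega) i :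
  effectively_open o U -> measurable (U i).
Proof.
move=> [c ->]; rewrite bigcup_mkcond; apply: countable_bigcupT_measurable.
  exact: countableP.
by move=> x; case: ifP => _; [exact: measurable_cylinder|exact: measurable0].
Qed.

Lemma btest_lty_random (w : Omega) : (@btest R w < +oo)%E ->
  exists p : R, 0 <= p <= 1 /\ ml_random_bernoulli p w.
Proof.
move=> boo.
have bfin : @btest R w \is a fin_num by rewrite ge0_fin_numE ?btest_ge0.
have [m nt] : exists m, ~ tested m w.
  apply: contrapT => /boolp.forallNP h.
  have [m] := pow2_gt (fine (@btest R w)); rewrite ltNge -lee_fin fineK//.
  by move=> /negP; apply; apply: btest_ge; apply: contrapT; exact: h.
(* This oracle, against which [m] is never reached, determines [p]. *)
have [a no] : exists o, forall l, ~ hit m l (prefix_num w l) (prefix_num o l).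
  apply: contrapT => h; apply: nt; right=> o; apply: contrapT => h'.
  by apply: h; exists o => l hl; apply: h'; exists l.
have [p p01 op] := expansion_cvg (R := R) a.
exists p; split=> //; exists a => // U oU PU wU.
have mU i := measurable_effectively_open i oU.
(* The value 2^i is attached to the set of index 2i + 1, since 2^i * 2^-(2i+1) = 2^-(i+1) and these
   sum to at most 1. *)
have [c0 c0U] := oU; have [|c cP] := @reindex c0 (fun i => 2 * i + 1)%N; first by comp.
have cU i : \bigcup_(x in enumerated a c i) cylinder x = U (2 * i + 1)%N.
  by rewrite cP c0U.
have [x xi wx] : (\bigcup_(x in enumerated a c (m + index c).+1) cylinder x) w.
  by rewrite cU; apply: wU.
suff /listed_hit : forall n, (\int[bernoulli_measure p]_w
    ((level (index c) n (prefix_num a n) (prefix_num w n))%:R : R)%:E <= 1)%E.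
  by move=> /(_ _ _ _ p01 op xi wx)[l /no].
move=> n.
(* A nonzero level is a single 2^i at a point of [U (2 * i + 1)], hence one of the terms of this
   sum. *)
apply: (@le_trans _ _ (\int[bernoulli_measure p]_w
    \sum_(i < n) ((2 ^+ i : R)%:E * (\1_(U (2 * i + 1)%N) w)%:E))%E).
  apply: ge0_integral_mono => w'; first by rewrite lee_fin.
  have s0 (Q : pred 'I_n) : (0 <= \sum_(i < n | Q i)
      ((2 ^+ i : R)%:E * (\1_(U (2 * i + 1)%N) w')%:E))%E.
    by apply: sume_ge0 => i _; rewrite mule_ge0 ?lee_fin ?exprn_ge0.
  have [->|/enumerated_level[i [y [lt_in -> iy wy]]]] :=
    posnP (level (index c) n (prefix_num a n) (prefix_num w' n)); first exact: s0.
  rewrite (bigD1 (Ordinal lt_in))//= indicE mem_set; last first.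
    by rewrite -cU; exists y.
  by rewrite mule1 natrX leeDl.
rewrite ge0_integral_sum//; last first.
  move=> i; apply: emeasurable_funM; first exact: measurable_cst.
  by apply/measurable_EFinP; exact: measurable_indic (mU _).
apply: (@le_trans _ _ (\sum_(i < n) (2 ^- i.+1 : R)%:E)%E).
  apply: lee_sum => i _; rewrite ge0_integralZl_EFin//; last first.
    by apply/measurable_EFinP; exact: measurable_indic (mU _).
  rewrite integral_indic// ?setIT.
  apply: le_trans (lee_wpmul2l _ (PU _)) _; first by rewrite lee_fin exprn_ge0.
  rewrite -EFinM lee_fin mul2n -addnn addn1 -addnS exprD invfM mulrA.
  by rewrite mulfV ?mul1r// expf_neq0.
rewrite sumEFin lee_fin.
have -> : \sum_(i < n) 2 ^- i.+1 = 1 - 2 ^- n :> R.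
  elim: (n) => [|k IH]; first by rewrite big_ord0 expr0 invr1 subrr.
  by rewrite big_ord_recr IH /= !exprS; field; rewrite expf_neq0.
by rewrite gerBl invr_ge0 exprn_ge0.
Qed.

Lemma random_btest_lty (w : Omega) (p : R) : 0 <= p <= 1 ->
  ml_random_bernoulli p w -> (@btest R w < +oo)%E.
Proof.
move=> p01 [a ap rw].
have [[_ lb _] _] := btest_universal; have [c cP] := lower_semicomputable_pow lb.
pose U i : set Omega := [set w | ((2 ^+ i : R)%:E < btest w)%E].
have oU : effectively_open a U by exists c => i; exact: cP.
rewrite ltNge; apply/negP => woo; apply: (rw U oU); last first.
  by move=> i _; rewrite /U /= (lt_le_trans _ woo)// ltry.
move=> i; have mU := measurable_effectively_open i oU.
have p2 : 0 < 2 ^+ i :> R by rewrite exprn_gt0.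
(* Markov's inequality: 2^i times the indicator of [U i] is at most [btest]. *)
have h : ((2 ^+ i : R)%:E * bernoulli_measure p (U i) <= 1)%E.
  rewrite -(setIT (U i)) -integral_indic// -ge0_integralZl_EFin//; last first.
    by apply/measurable_EFinP; exact: measurable_indic.
  apply: le_trans (integral_btest p01); apply: ge0_integral_mono => w'.
    by rewrite mule_ge0 ?lee_fin// ltW.
  rewrite indicE; have [|_] := boolP (w' \in U i); last by rewrite mule0 btest_ge0.
  by rewrite inE mule1 => /ltW.
by rewrite -(@lee_pmul2l _ (2 ^+ i)%:E) ?lte_fin// -EFinM mulfV ?gt_eqF.
Qed.

End universal.

Theorem theorem8 (R : realType) (w : Omega) :
  bernoulli_sequence R w <->
  exists p : R, 0 <= p <= 1 /\ ml_random_bernoulli p w.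
Proof.
split=> [[t [[t0 _ _] max_t] tw]|[p [p01 pw]]]; last first.
  by exists btest; [exact: btest_universal|exact: random_btest_lty p01 pw].
(* The given universal test dominates [btest] up to a constant, so finiteness carries over. *)
have [bt _] := @btest_universal R; have [c c0 h] := max_t _ bt.
apply: btest_lty_random; apply: le_lt_trans (h w) _.
by rewrite lte_mul_pinfty ?lee_fin// ltW.
Qed.
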